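(* Let $(W,S)$ be a finitely generated Coxeter system and $\Lambda=\Lambda(W,S)$ its Cayley graph. Let $\beta$ be an edge path ray in $\Lambda$ that is a quasi-geodesic. Then $\beta$ is tracked by a geodesic edge path in $\Lambda$ if and only if $\beta$ has bounded bracket number.
   Context: A Coxeter system $(W,S)$ is a group $W$ with generating set $S$ and presentation $\langle S : (s_is_j)^{m(i,j)}\rangle$, where $m(i,j)=m(j,i)\in\{1,2,\ldots,\infty\}$, $m(i,j)=1$ iff $i=j$, and the relation is omitted if $m(i,j)=\infty$; it is finitely generated if $S$ is finite. The Cayley graph $\Lambda(W,S)$ has vertex set $W$ and, for each $w\in W$, $s\in S$, a single edge of length 1 labeled $s$ joining $w$ and $ws$; $d$ is the path metric, and $W$ acts on the left. A reflection is a conjugate in $W$ of an element of $S$. The wall $Q$ of a reflection is the set of edges of $\Lambda$ that are mapped to themselves (set-wise, with end vertices interchanged) by that reflection. Each edge belongs to exactly one wall. A finite edge path is a continuous map $\beta:[0,n]\to\Lambda$, $n$ a positive integer, mapping each $[k,k+1]$ ($k$ an integer) isometrically onto an edge; a ray is such a map on $[0,\infty)$ and a line is such a map on $(-\infty,\infty)$. An edge path is geodesic if $d(\beta(s),\beta(t))=|s-t|$ for all integers $s,t$ in its domain. It is a $(\lambda,\epsilon)$-quasi-geodesic if $|s-t|\le\lambda d(\beta(s),\beta(t))+\epsilon$ for all integers $s,t$ in its domain, and a quasi-geodesic if this holds for some real constants $\lambda>0,\epsilon\ge0$. For a vertex $t=\beta(k)$ of an edge path $\beta$, the bracket number $B(t,\beta)$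 is the number of walls $Q$ such that $\beta$ has an edge of $Q$ on either side of $t$ (one at or before position $k$ and one at or after position $k$). The path $\beta$ has bounded bracket number if the numbers $B(t,\beta)$, over all vertices $t$ of $\beta$, are bounded. An edge path $\beta$ is $K$-tracked by an edge path $\alpha$ if each vertex of $\beta$ is within distance $K$ of a vertex of $\alpha$; it is tracked by $\alpha$ if it is $K$-tracked by $\alpha$ for some $K$. *)

(* Defs.v *)
From mathcomp Require Import all_boot all_order all_algebra.
From mathcomp Require Import monoid.
From mathcomp Require Import boolp classical_sets functions cardinality reals.

Set Implicit Arguments.
Unset Strict Implicit.
Unset Printing Implicit Defensive.

Import Order.TTheory GRing.Theory Num.Theory.

Local Open Scope classical_set_scope.
Local Open Scope card_scope.
Local Open Scope group_scope.

(* A word over the generators and their formal inverses: the letter (s, true)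
   stands for s and (s, false) for s^-1. *)
Definition word (S : Type) := seq (S * bool).

Section Presentation.
Variables (W : groupType) (S : Type) (gen : S -> W).

Definition letter_val (l : S * bool) : W :=
  if l.2 then gen l.1 else (gen l.1)^-1.

Definition word_val (u : word S) : W := \prod_(l <- u) letter_val l.

(* Equality of words in the group < S : rel >: the congruence generated by
   free cancellation and by the relators. *)
Inductive pres_eq (rel : set (word S)) : word S -> word S -> Prop :=
| pres_refl u : pres_eq rel u u
| pres_sym u v : pres_eq rel u v -> pres_eq rel v u
| pres_trans u v w : pres_eq rel u v -> pres_eq rel v w -> pres_eq rel u w
| pres_cancel u s b v : pres_eq rel (u ++ [:: (s, b); (s, ~~ b)] ++ v) (u ++ v)
| pres_relator u r v : rel r -> pres_eq rel (u ++ r ++ v) (u ++ v).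

(* Evaluation of words induces an isomorphism from < S : rel > onto W. *)
Definition presented_by (rel : set (word S)) : Prop :=
  (forall w : W, exists u, word_val u = w) /\
  (forall u v, word_val u = word_val v <-> pres_eq rel u v).

End Presentation.

(* [None] stands for m(i,j) = oo. *)
Definition coxeter_matrix (S : Type) (m : S -> S -> option nat) : Prop :=
  [/\ forall i j, m i j = m j i,
      forall i j n, m i j = Some n -> (0 < n)%N
    & forall i j, m i j = Some 1%N <-> i = j].

Definition coxeter_relators (S : Type) (m : S -> S -> option nat) :
    set (word S) :=
  [set r | exists i j n, m i j = Some n /\
                         r = flatten (nseq n [:: (i, true); (j, true)])].

(* The generating set is given as a subset of W, that is, as an injective
   family [gen] indexed by a (finite) type S. *)
Definition coxeter_system (W : groupType) (S : finType)
    (m : S -> S -> option nat) (gen : S -> W) : Prop :=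
  [/\ coxeter_matrix m, injective gen & presented_by gen (coxeter_relators m)].

Section CayleyGraph.
Variables (W : groupType) (S : finType) (gen : S -> W).

Definition adjacent (x y : W) : bool := [exists s, y == x * gen s].

Definition joined_in (x y : W) : set nat :=
  [set n | exists p : seq W, [/\ path adjacent x p, last x p = y & size p = n]].

(* The default value is irrelevant: the Cayley graph is connected as soon as
   [gen] generates W. *)
Definition dist (x y : W) : nat :=
  xget 0%N [set n | joined_in x y n /\
                    forall n', joined_in x y n' -> (n <= n')%N].

(* In a Coxeter system the elements of S are distinct from one another and
   from 1, and w, ws are joined by a single edge; the Cayley graph is hence
   simple and an edge is determined by its set of end vertices. *)
Definition edge (x y : W) : set W := [set x; y].

Definition reflection (r : W) : Prop := exists w s, r = w * gen s * w^-1.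

Definition wall_of (r : W) : set (set W) :=
  [set e | exists w s, [/\ e = edge w (w * gen s),
                           r * w = w * gen s & r * (w * gen s) = w]].

Definition is_wall (Q : set (set W)) : Prop :=
  exists2 r, reflection r & Q = wall_of r.

End CayleyGraph.

(* The domains [0,n], [0,oo) and (-oo,oo). *)
Variant path_shape := Segment of nat | Ray | Line.

Definition in_dom (D : path_shape) (k : int) : bool :=
  match D with
  | Segment n => (0 <= k <= n%:Z)%R
  | Ray => (0 <= k)%R
  | Line => true
  end.

Section EdgePaths.
Variables (W : groupType) (S : finType) (gen : S -> W).
Implicit Types (D : path_shape) (a b : int -> W) (k : int).

(* Since the Cayley graph is simple, an edge path is determined by its
   vertices; the values of b outside of the domain are irrelevant. *)
Definition edge_path D b : Prop :=
  (if D is Segment n then (0 < n)%N else true) /\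
  (forall k, in_dom D k -> in_dom D (k + 1)%R -> adjacent gen (b k) (b (k + 1)%R)).

Definition geodesic D b : Prop :=
  forall k l, in_dom D k -> in_dom D l ->
    ((dist gen (b k) (b l))%:Z = `|k - l|)%R.

Definition quasi_geodesic_with (R : realType) (lam eps : R) D b : Prop :=
  forall k l, in_dom D k -> in_dom D l ->
    (`|k - l|%:~R <= lam * (dist gen (b k) (b l))%:R + eps)%R.

Definition quasi_geodesic (R : realType) D b : Prop :=
  exists lam eps : R,
    [/\ (0 < lam)%R, (0 <= eps)%R & quasi_geodesic_with lam eps D b].

Definition path_edge b k : set W := edge (b k) (b (k + 1)%R).

(* The walls counted by the bracket number B(b(k), b): an edge [i, i+1] of b
   lies before position k if i + 1 <= k, and an edge [j, j+1] lies after it if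
   k <= j. *)
Definition bracketing_walls D b k : set (set (set W)) :=
  [set Q | is_wall gen Q /\ exists i j,
     [/\ in_dom D i && in_dom D (i + 1)%R, in_dom D j && in_dom D (j + 1)%R,
         (i + 1 <= k <= j)%R, Q (path_edge b i) & Q (path_edge b j)]].

Definition bounded_bracket_number D b : Prop :=
  exists N : nat, forall k, in_dom D k -> bracketing_walls D b k #<= `I_N.

(* b (with domain D) is tracked by a (with domain E). *)
Definition K_tracked (K : nat) D b E a : Prop :=
  forall k, in_dom D k ->
    exists2 l, in_dom E l & (dist gen (b k) (a l) <= K)%N.

Definition tracked D b E a : Prop := exists K, K_tracked K D b E a.

End EdgePaths.

(* Main.v *)
(* Walls correspond to roots of the geometric representation up to sign, and the
   side of a wall on which a vertex w lies is the sign of w^-1 applied to the root.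

   The main tool is the parallel wall theorem: a wall far from a vertex z is
   separated from z by many walls.  Write a positive root as the end of a chain
   of simple reflections that increase it.  Each step at which the form is at
   most -1 contributes a separating wall, and a run of steps with values in
   (-1, 0) has bounded length: on pairs of roots the form takes finitely many
   values in (-1, 1), and a recurrence of the vector of values on the simple
   roots would allow the chain to be continued backwards forever.

   If beta is tracked by a geodesic alpha, a wall bracketing beta(k) is close to
   alpha on both sides of a point z of alpha near beta(k).  A wall separating z
   from it would, up to a bounded number of exceptions, be crossed twice by
   alpha, so the wall is close to beta(k), and only finitely many walls are.

   Conversely, let at most N walls bracket each vertex.  Inductively choose p_k
   near beta(k) and lying between p_(k-1) and all beta(j), j >= k.  The walls
   obstructing this at a vertex u (starting from u = beta(k)) separate u from
   p_(k-1) and from some beta(j), so they bracket beta(k) and are at most N.  By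
   the parallel wall theorem they are close to u, hence can be crossed one at a
   time by bounded moves along geodesics towards p_(k-1).  Geodesics from
   p_(k-1) to p_k concatenate to a geodesic ray tracking beta. *)
Require Import Defs.
From mathcomp Require Import all_boot all_order all_algebra.
From mathcomp Require Import monoid.
From mathcomp Require Import boolp classical_sets functions cardinality reals.
From mathcomp Require Import trigo.
From mathcomp Require Import ring lra zify.

Set Implicit Arguments.
Unset Strict Implicit.
Unset Printing Implicit Defensive.

Import Order.TTheory GRing.Theory Num.Theory.

Local Open Scope ring_scope.

Section CoxeterGroup.

Variables (R : realType) (W : groupType) (S : finType).
Variables (m : S -> S -> option nat) (gen : S -> W).
Hypothesis HW : coxeter_system m gen.

Local Notation V := {ffun S -> R^o}.

(** * The geometric representation *)

Definition cox (s t : S) : R := if m s t is Some n then - cos (pi / n%:R) else -1.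

Definition alpha (s : S) : V := [ffun t => (t == s)%:R].

Definition form (u v : V) : R := \sum_s \sum_t (u s : R) * (v t : R) * cox s t.

Definition sigma (s : S) (v : V) : V := v - (2 * form v (alpha s)) *: alpha s.

Definition nonneg (v : V) := forall t, 0 <= v t.
Definition nonpos (v : V) := forall t, v t <= 0.

Lemma addVE (u v : V) t : (u + v) t = u t + v t. Proof. by rewrite ffunE. Qed.
Lemma oppVE (u : V) t : (- u) t = - u t. Proof. by rewrite ffunE. Qed.
Lemma scaleVE a (u : V) t : (a *: u) t = a * u t. Proof. by rewrite ffunE. Qed.
Lemma zeroVE t : (0 : V) t = 0. Proof. by rewrite ffunE. Qed.
Lemma alphaE s t : alpha s t = (t == s)%:R. Proof. by rewrite ffunE. Qed.
Definition VE := (addVE, oppVE, scaleVE, zeroVE).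

Lemma mC s t : m s t = m t s. Proof. by case: HW => -[]. Qed.
Lemma m_gt0 s t n : m s t = Some n -> (0 < n)%N.
Proof. by case: HW => -[_ + _] _ _; apply. Qed.
Lemma m_eq1 s t : m s t = Some 1%N <-> s = t.
Proof. by case: HW => -[_ _ +] _ _; apply. Qed.
Lemma mss s : m s s = Some 1%N. Proof. exact/m_eq1. Qed.
Lemma m_gt1 s t n : s != t -> m s t = Some n -> (1 < n)%N.
Proof.
move=> st mn; have := m_gt0 mn; case: n mn => [|[|n]] // mn _.
by move/m_eq1: mn st => ->; rewrite eqxx.
Qed.

Lemma coxC s t : cox s t = cox t s. Proof. by rewrite /cox mC. Qed.
Lemma coxss s : cox s s = 1.
Proof. by rewrite /cox mss divr1 cospi opprK. Qed.

Lemma angle_bounds n k : (1 < n)%N -> (k <= n)%N -> 0 <= k%:R * (@pi R / n%:R) <= @pi R.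
Proof.
move=> n1 kn; have n0 : 0 < n%:R :> R by rewrite ltr0n; lia.
have pi0 := @pi_gt0 R.
rewrite mulr_ge0 ?divr_ge0 ?ler0n ?(ltW pi0)//= mulrA ler_pdivrMr// mulrC.
by rewrite ler_pM2l// ler_nat.
Qed.

Lemma sin_angle_gt0 n : (1 < n)%N -> 0 < sin (pi / n%:R) :> R.
Proof.
move=> n1; have n0 : 1 < n%:R :> R by rewrite ltr1n.
have pi0 := @pi_gt0 R.
apply: sin_gt0_pi; rewrite divr_gt0//=; last by lra.
by rewrite ltr_pdivrMr ?(lt_trans _ n0)// ltr_pMr.
Qed.

Lemma cox_le0 s t : s != t -> cox s t <= 0.
Proof.
move=> st; rewrite /cox; case E: (m s t) => [n|]; last by rewrite lerN10.
have n1 := m_gt1 st E; have n0 : 0 < n%:R :> R by rewrite ltr0n; lia.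
have pi0 := @pi_gt0 R.
rewrite oppr_le0 cos_ge0_pihalf//; apply/andP; split.
  by apply: (@le_trans _ _ 0); rewrite ?oppr_le0 divr_ge0// ltW.
by rewrite ler_pM2l// lef_pV2// ?posrE// ler_nat.
Qed.

Lemma formC u v : form u v = form v u.
Proof.
rewrite /form exchange_big; apply: eq_bigr => s _; apply: eq_bigr => t _.
by rewrite coxC; ring.
Qed.

Lemma formDl u v w : form (u + v) w = form u w + form v w.
Proof.
rewrite /form -big_split; apply: eq_bigr => s _; rewrite -big_split.
by apply: eq_bigr => t _; rewrite VE /=; ring.
Qed.

Lemma formZl a u w : form (a *: u) w = a * form u w.
Proof.
rewrite /form big_distrr; apply: eq_bigr => s _; rewrite big_distrr.
by apply: eq_bigr => t _; rewrite VE /=; ring.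
Qed.

Lemma formNl u w : form (- u) w = - form u w.
Proof. by rewrite -scaleN1r formZl mulN1r. Qed.

Lemma formDr u v w : form w (u + v) = form w u + form w v.
Proof. by rewrite formC formDl !(formC w). Qed.

Lemma formZr a u w : form w (a *: u) = a * form w u.
Proof. by rewrite formC formZl !(formC w). Qed.

Lemma formNr u w : form w (- u) = - form w u.
Proof. by rewrite formC formNl !(formC w). Qed.

Lemma form0l w : form 0 w = 0.
Proof. by rewrite -(scale0r 0) formZl mul0r. Qed.

Definition formE := (formDl, formDr, formNl, formNr, formZl, formZr).

Lemma form_alphar u t : form u (alpha t) = \sum_s (u s : R) * cox s t.
Proof.
apply: eq_bigr => s _; rewrite (bigD1 t)//= big1 => [|i /negPf it].
  by rewrite alphaE eqxx mulr1 addr0.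
by rewrite alphaE it mulr0 mul0r.
Qed.

Lemma form_alpha s t : form (alpha s) (alpha t) = cox s t.
Proof.
rewrite form_alphar (bigD1 s)//= big1 => [|i /negPf it].
  by rewrite alphaE eqxx mul1r addr0.
by rewrite alphaE it mul0r.
Qed.

Lemma form_expandr u v : form u v = \sum_t (v t : R) * form u (alpha t).
Proof.
rewrite /form exchange_big; apply: eq_bigr => t _ /=.
rewrite -/(form u (alpha t)) form_alphar big_distrr; apply: eq_bigr => s _ /=; ring.
Qed.

Lemma vec_expand (v : V) : v = \sum_t v t *: alpha t.
Proof.
apply/ffunP => s; rewrite sum_ffunE (bigD1 s)//= big1 => [|i /negPf it].
  by rewrite VE alphaE eqxx mulr1 addr0.
by rewrite VE alphaE eq_sym it mulr0.
Qed.

Lemma sigmaD s u v : sigma s (u + v) = sigma s u + sigma s v.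
Proof. by apply/ffunP=> t; rewrite /sigma formE !VE; ring. Qed.
Lemma sigmaZ s a v : sigma s (a *: v) = a *: sigma s v.
Proof. by apply/ffunP=> t; rewrite /sigma formE !VE; ring. Qed.
Lemma sigma_alpha s : sigma s (alpha s) = - alpha s.
Proof. by apply/ffunP=> t; rewrite /sigma form_alpha coxss !VE; ring. Qed.
Lemma sigmaK s : involutive (sigma s).
Proof.
move=> v; apply/ffunP=> t; rewrite /sigma !formE form_alpha coxss !VE; ring.
Qed.
Lemma form_sigma s u v : form (sigma s u) (sigma s v) = form u v.
Proof. by rewrite /sigma !formE form_alpha coxss (formC (alpha s) v); ring. Qed.

Definition wact (u : seq S) (v : V) : V := foldr sigma v u.

Lemma wact_cat u1 u2 v : wact (u1 ++ u2) v = wact u1 (wact u2 v).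
Proof. exact: foldr_cat. Qed.
Lemma wactD u v1 v2 : wact u (v1 + v2) = wact u v1 + wact u v2.
Proof. by elim: u => //= s u ->; rewrite sigmaD. Qed.
Lemma wactZ u a v : wact u (a *: v) = a *: wact u v.
Proof. by elim: u => //= s u ->; rewrite sigmaZ. Qed.
Lemma wact_form u v1 v2 : form (wact u v1) (wact u v2) = form v1 v2.
Proof. by elim: u => //= s u <-; rewrite form_sigma. Qed.

(* The Chebyshev polynomials of the second kind, shifted so that
   [cheb (cos x) k = sin (k x) / sin x]. *)
Fixpoint cheb2 (c : R) k : R * R :=
  if k is k'.+1 then let: (x, y) := cheb2 c k' in (y, 2 * c * y - x) else (0, 1).
Definition cheb c k := (cheb2 c k).1.

Lemma chebS c k : cheb c k.+1 = (cheb2 c k).2.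
Proof. by rewrite /cheb /=; case: (cheb2 c k). Qed.
Lemma chebSS c k : cheb c k.+2 = 2 * c * cheb c k.+1 - cheb c k.
Proof. by rewrite !chebS /= /cheb; case: (cheb2 c k). Qed.

Lemma cheb_cos x k : cheb (cos x) k * sin x = sin (k%:R * x).
Proof.
suff: cheb (cos x) k * sin x = sin (k%:R * x) /\
      cheb (cos x) k.+1 * sin x = sin (k.+1%:R * x) by case.
elim: k => [|k [IH1 IH2]]; first by rewrite /cheb /= mul0r !mul1r mul0r sin0.
split=> //; rewrite chebSS mulrBl IH1 -(mulrA (2 * cos x)) IH2.
rewrite [k.+2%:R]mulrSr [k.+1%:R]mulrSr !mulrDl !mul1r !sinD !cosD.
have := cos2Dsin2 x; set a := sin (_ * _); set b := cos (_ * _).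
by move=> /(congr1 (fun y => y * a)); lra.
Qed.

Lemma cheb_one k : cheb 1 k = k%:R.
Proof.
suff: cheb 1 k = k%:R /\ cheb 1 k.+1 = k.+1%:R by case.
elim: k => [|k [IH1 IH2]]; first by rewrite /cheb.
by split=> //; rewrite chebSS IH1 IH2 [k.+2%:R]mulrSr [k.+1%:R]mulrSr; ring.
Qed.

(** Up to the positive factor [sin (pi / n)] this is [sin (k pi / n)], an angle in [0, pi]; for the
    label oo the cosine degenerates to 1 and the value is [k]. *)
Lemma cheb_ge0 s t k : s != t -> is_true (if m s t is Some n then k <= n else true)%N ->
  0 <= cheb (- cox s t) k.
Proof.
move=> st; rewrite /cox; case E: (m s t) => [n|] => [kn|_]; rewrite opprK; last first.
  by rewrite cheb_one ler0n.
have n1 := m_gt1 st E; have s0 := sin_angle_gt0 n1.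
rewrite -(pmulr_lge0 _ s0) cheb_cos; apply: sin_ge0_pi; exact: angle_bounds.
Qed.

Lemma sigma_pair1 s t x y :
  sigma t (x *: alpha s + y *: alpha t) =
  x *: alpha s + (2 * - cox s t * x - y) *: alpha t.
Proof. by apply/ffunP=> r; rewrite /sigma !formE !form_alpha coxss !VE; ring. Qed.

Lemma sigma_pair2 s t x y :
  sigma s (x *: alpha s + y *: alpha t) =
  (2 * - cox s t * y - x) *: alpha s + y *: alpha t.
Proof. by rewrite addrC sigma_pair1 addrC coxC. Qed.

Lemma rotation_alpha s t k : let c := - cox s t in
  iter k (sigma s \o sigma t) (alpha s) =
    cheb c k.*2.+1 *: alpha s + cheb c k.*2 *: alpha t /\
  iter k (sigma s \o sigma t) (alpha t) =
    - cheb c k.*2 *: alpha s + (cheb c k.*2.+1 - 2 * c * cheb c k.*2) *: alpha t.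
Proof.
move=> c; elim: k => [|k [IH1 IH2]].
  by split; rewrite /= /cheb /= ?oppr0 ?mulr0 ?subr0 ?scale0r ?scale1r ?addr0 ?add0r.
rewrite !iterS doubleS IH1 IH2 /= !sigma_pair1 !sigma_pair2 -/c !chebSS.
by split; apply/ffunP=> r; rewrite !VE; ring.
Qed.

Lemma sigma_orth s v : form v (alpha s) = 0 -> sigma s v = v.
Proof. by rewrite /sigma => ->; rewrite mulr0 scale0r subr0. Qed.

(** For distinct [s] and [t] the form is nondegenerate on the plane of [alpha s] and [alpha t].
    Hence [v] splits into a part orthogonal to the plane, fixed by both reflections, and a part on
    which their product is a rotation by 2 pi / n. *)
Lemma rotation_order s t n : m s t = Some n ->
  forall v, iter n (sigma s \o sigma t) v = v.
Proof.
move=> mn v; have [st|st] := eqVneq s t.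
  by rewrite st mss in mn *; case: mn => <-; rewrite /= sigmaK.
have n1 := m_gt1 st mn; have s0 := @sin_angle_gt0 n n1.
have cE : - cox s t = cos (pi / n%:R) by rewrite /cox mn opprK.
have n0 : n%:R != 0 :> R by rewrite pnatr_eq0; lia.
have E2 k : cheb (- cox s t) (n.*2 + k) = cheb (- cox s t) k.
  apply: (mulIf (lt0r_neq0 s0)); rewrite cE !cheb_cos natrD mulrDl.
  rewrite -muln2 natrM -mulrA mulrCA (mulrCA n%:R) divff// mulr1.
  by rewrite sinD (mulr_natl pi 2) sin2pi cos2pi mul0r add0r mul1r.
have [Es Et] := rotation_alpha s t n.
rewrite -(addn1 n.*2) E2 -(addn0 n.*2) E2 in Es Et.
have d0 : 1 - cox s t ^+ 2 != 0.
  by rewrite -sqrrN cE -sin2cos2 expf_neq0// lt0r_neq0.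
pose p := form v (alpha s); pose q := form v (alpha t).
(* [x] and [y] solve the linear system that makes [v0] orthogonal to both simple roots. *)
pose x := (p - cox s t * q) / (1 - cox s t ^+ 2).
pose y := (q - cox s t * p) / (1 - cox s t ^+ 2).
pose v0 := v - (x *: alpha s + y *: alpha t).
have v0s : form v0 (alpha s) = 0.
  by rewrite /v0 !formE !form_alpha coxss (coxC t) -/p /x /y; field.
have v0t : form v0 (alpha t) = 0.
  by rewrite /v0 !formE !form_alpha coxss -/q /x /y; field.
have -> : v = v0 + (x *: alpha s + y *: alpha t) by rewrite /v0 subrK.
have lin k a1 u1 a2 u2 : iter k (sigma s \o sigma t) (v0 + (a1 *: u1 + a2 *: u2)) =
    v0 + (a1 *: iter k (sigma s \o sigma t) u1 + a2 *: iter k (sigma s \o sigma t) u2).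
  elim: k => //= k ->; set u := iter k _ u1; set w := iter k _ u2.
  rewrite (sigmaD t v0) (sigmaD t (a1 *: u)) !(sigmaZ t) (sigma_orth v0t).
  by rewrite (sigmaD s v0) (sigmaD s (a1 *: _)) !(sigmaZ s) (sigma_orth v0s).
rewrite lin Es Et; rewrite /cheb /=.
by apply/ffunP=> r; rewrite !VE; ring.
Qed.

(** * Words and length *)

Definition wval (u : seq S) : W := foldr (fun s w => (gen s * w)%g) 1%g u.

Lemma wval_cat u1 u2 : wval (u1 ++ u2) = (wval u1 * wval u2)%g.
Proof. by elim: u1 => [|s u IH] /=; rewrite ?mul1g// IH mulgA. Qed.

Definition lift_word (u : seq S) : word S := [seq (s, true) | s <- u].

Lemma word_val_cons l (u : word S) : word_val gen (l :: u) = (letter_val gen l * word_val gen u)%g.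
Proof. by rewrite /word_val big_cons. Qed.

Lemma word_val_lift u : word_val gen (lift_word u) = wval u.
Proof.
by elim: u => [|s u IH]; rewrite /= ?word_val_cons ?IH// /word_val big_nil.
Qed.

Lemma pres_presented : presented_by gen (coxeter_relators m).
Proof. by case: HW. Qed.

Lemma genK s : (gen s * gen s = 1)%g.
Proof.
have [_ P] := pres_presented.
have : word_val gen (lift_word [:: s; s]) = word_val gen [::].
  apply/P; have := @pres_relator S (coxeter_relators m) [::] (lift_word [:: s; s]) [::].
  by apply; exists s, s, 1%N; rewrite mss.
by rewrite word_val_lift /word_val big_nil /= mulg1.
Qed.

Lemma genV s : ((gen s)^-1 = gen s)%g.
Proof. by apply: mulg1_eq; exact: genK. Qed.

Lemma mulgenK (w : W) s : (w * gen s * gen s = w)%g.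
Proof. by rewrite -mulgA genK mulg1. Qed.

Lemma mulKgen (w : W) s : (gen s * (gen s * w) = w)%g.
Proof. by rewrite mulgA genK mul1g. Qed.

Lemma word_val_fst (u : word S) : word_val gen u = wval (map fst u).
Proof.
elim: u => [|[s b] u IH]; first by rewrite /word_val big_nil.
by rewrite word_val_cons IH /= /letter_val /=; case: b; rewrite ?genV.
Qed.

Lemma wval_surj w : exists u, wval u = w.
Proof.
by have [/(_ w) [u <-] _] := pres_presented; exists (map fst u); rewrite word_val_fst.
Qed.

Lemma wval_rev u : wval (rev u) = (wval u)^-1%g.
Proof.
elim: u => [|s u IH]; first by rewrite /= invg1.
by rewrite rev_cons -cats1 wval_cat IH /= invgM genV mulg1.
Qed.

Lemma wact_flatten s t n v :
  wact (flatten (nseq n [:: s; t])) v = iter n (sigma s \o sigma t) v.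
Proof. by elim: n => [//|n IH]; rewrite iterS -IH. Qed.

(** Relators act trivially by [rotation_order], so the action of words descends to [W]. *)
Lemma pres_wact u v : pres_eq (coxeter_relators m) u v ->
  forall x, wact (map fst u) x = wact (map fst v) x.
Proof.
elim=> {u v} [//|u v _ IH x|u v w _ IH1 _ IH2 x|u s b v x|u r v [s [t [n [mn ->]]]] x].
- by rewrite IH.
- by rewrite IH1.
- by rewrite !map_cat !wact_cat /= sigmaK.
rewrite !map_cat !wact_cat; congr (wact _ _).
have -> : map fst (flatten (nseq n [:: (s, true); (t, true)])) = flatten (nseq n [:: s; t]).
  by elim: n {mn} => //= n ->.
by rewrite wact_flatten (rotation_order mn).
Qed.

Lemma wact_wval u1 u2 : wval u1 = wval u2 -> forall v, wact u1 v = wact u2 v.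
Proof.
have [_ P] := pres_presented; rewrite -!word_val_lift => /P/pres_wact H v.
have fstK u : map fst (lift_word u) = u by rewrite -map_comp map_id.
by have := H v; rewrite !fstK.
Qed.

Definition act (w : W) : V -> V := wact (sval (cid (wval_surj w))).

Lemma act_wval u v : act (wval u) v = wact u v.
Proof. by rewrite /act; case: cid => u' /= /wact_wval. Qed.

Lemma actM (x y : W) v : act (x * y)%g v = act x (act y v).
Proof.
have [u <-] := wval_surj x; have [u' <-] := wval_surj y.
by rewrite -wval_cat !act_wval wact_cat.
Qed.

Lemma act1 v : act 1%g v = v. Proof. by have := act_wval [::] v. Qed.
Lemma act_gen s v : act (gen s) v = sigma s v.
Proof. by have := act_wval [:: s] v; rewrite /= mulg1. Qed.
Lemma actD w u v : act w (u + v) = act w u + act w v.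
Proof. exact: wactD. Qed.
Lemma actZ w a v : act w (a *: v) = a *: act w v.
Proof. exact: wactZ. Qed.
Lemma actN w v : act w (- v) = - act w v.
Proof. by rewrite -scaleN1r actZ scaleN1r. Qed.
Lemma act_form w u v : form (act w u) (act w v) = form u v.
Proof. exact: wact_form. Qed.
Lemma actK (w : W) : cancel (act w) (act w^-1%g).
Proof. by move=> v; rewrite -actM mulVg act1. Qed.
Lemma actVK (w : W) : cancel (act w^-1%g) (act w).
Proof. by move=> v; rewrite -actM mulgV act1. Qed.
Lemma act_inj w : injective (act w). Proof. exact: can_inj (actK w). Qed.

Lemma len_ex (w : W) : exists n, `[< exists2 u, wval u = w & size u = n >].
Proof. by have [u E] := wval_surj w; exists (size u); apply/asboolP; exists u. Qed.

Definition len (w : W) := ex_minn (len_ex w).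

Lemma lenP (w : W) : exists2 u, wval u = w & size u = len w.
Proof. by rewrite /len; case: ex_minnP => n /asboolP. Qed.

Lemma len_wval u : (len (wval u) <= size u)%N.
Proof. by rewrite /len; case: ex_minnP => n _; apply; apply/asboolP; exists u. Qed.

Lemma lenM (x y : W) : (len (x * y)%g <= len x + len y)%N.
Proof.
have [u <- <-] := lenP x; have [v <- <-] := lenP y.
by rewrite -wval_cat -size_cat len_wval.
Qed.

Lemma lenV (x : W) : len x^-1%g = len x.
Proof.
suff H y : (len y^-1%g <= len y)%N by apply/eqP; rewrite eqn_leq H -{1}(invgK x) H.
by have [u <- <-] := lenP y; rewrite -wval_rev -(size_rev u) len_wval.
Qed.

Lemma len_gen s : (len (gen s) <= 1)%N.
Proof. by have := len_wval [:: s]; rewrite /= mulg1. Qed.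

Lemma len1 : len 1%g = 0%N.
Proof. by apply/eqP; rewrite -leqn0; exact: (len_wval [::]). Qed.

Lemma len_eq0 (w : W) : len w = 0%N -> w = 1%g.
Proof. by have [u <- <-] := lenP w; move/size0nil=> ->. Qed.

Lemma lenMgen (w : W) s : (len (w * gen s)%g <= (len w).+1)%N.
Proof. by rewrite -addn1 (leq_trans (lenM _ _))// leq_add2l len_gen. Qed.

Lemma lengenM (w : W) s : (len (gen s * w)%g <= (len w).+1)%N.
Proof. by rewrite -add1n (leq_trans (lenM _ _))// leq_add2r len_gen. Qed.

Lemma len_descent (w : W) : w != 1%g -> exists t, (len w = (len (w * gen t)%g).+1)%N.
Proof.
have [u uw su] := lenP w; case/lastP: u uw su => [<-|u t uw su _]; first by rewrite eqxx.
exists t; have wE : (w * gen t)%g = wval u.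
  by rewrite -uw -cats1 wval_cat /= mulg1 mulgenK.
have := lenMgen (w * gen t)%g t; rewrite mulgenK wE -su size_rcons.
by have := len_wval u; lia.
Qed.

Lemma len_descentl (w : W) : w != 1%g -> exists s, (len w = (len (gen s * w)%g).+1)%N.
Proof.
rewrite -invg_eq1 => /len_descent[s sE].
by exists s; rewrite -lenV sE -lenV invgM genV invgK.
Qed.

(** The alternating word of length [k] that ends in [t]; prolonging it adds a letter in front. *)
Fixpoint alt (s t : S) k : seq S :=
  if k is k'.+1 then (if odd k' then s else t) :: alt s t k' else [::].

Lemma alt_cat s t j k : exists pre, size pre = j /\ alt s t (j + k) = pre ++ alt s t k.
Proof.
elim: j => [|j [pre [sp E]]]; first by exists [::].
by rewrite addSn /= E; eexists (_ :: pre); rewrite /= sp.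
Qed.

Lemma wval_alt s t k : wval (alt s t k) =
  (if odd k then gen t * (gen s * gen t) ^+ k./2 else (gen s * gen t) ^+ k./2)%g.
Proof.
elim: k => [|k IH] //=; rewrite IH uphalf_half; case: (odd k) => //=.
by rewrite add1n expgS mulgA.
Qed.

Lemma gen_order s t n : m s t = Some n -> ((gen s * gen t) ^+ n = 1)%g.
Proof.
move=> mn; have [_ P] := pres_presented.
have : word_val gen (flatten (nseq n [:: (s, true); (t, true)])) = word_val gen [::].
  apply/P; have := @pres_relator S (coxeter_relators m) [::]
    (flatten (nseq n [:: (s, true); (t, true)])) [::].
  by rewrite cats0; apply; exists s, t, n.
rewrite /word_val big_nil => <-; elim: n {mn} => [|n IH]; first by rewrite big_nil.
by rewrite expgS IH /= !big_cons mulgA.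
Qed.

Lemma braid s t n : m s t = Some n -> wval (alt s t n) = wval (alt t s n).
Proof.
move/gen_order; rewrite !wval_alt; set a := gen s; set b := gen t => E.
have abV : ((a * b)^-1 = b * a)%g by rewrite invgM !genV.
rewrite -abV expVgn; move: E; rewrite -{1}(odd_double_half n) -addnn !expgnDr.
move: (n./2) => k; case: (odd n) => /=; last by rewrite mul1g => /mulg1_eq.
rewrite expg1 => /mulg1_eq; rewrite abV => E.
transitivity (b * (b * a * (a * b) ^- k))%g; first by rewrite E mulgK.
by rewrite !mulgA /b genK mul1g.
Qed.

(** * Positive and negative roots *)

Lemma alt_alpha s t k (c := - cox s t) : wact (alt s t k) (alpha s) =
  if odd k then cheb c k *: alpha s + cheb c k.+1 *: alpha t
  else cheb c k.+1 *: alpha s + cheb c k *: alpha t.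
Proof.
elim: k => [|k IH]; first by rewrite /cheb /= scale1r scale0r addr0.
rewrite [wact _ _]/= IH [odd k.+1]/= chebSS; case: (odd k).
  by rewrite sigma_pair2.
by rewrite sigma_pair1.
Qed.

(** A reduced word has no two equal adjacent letters, and as [s] is no right descent the last letter
    is [t]. *)
Lemma dihedral_word s t (d : seq S) : all [pred x | (x == s) || (x == t)] d ->
  size d = len (wval d) -> (size d <= len (wval d * gen s)%g)%N ->
  d = alt s t (size d).
Proof.
elim: d => //= a d IH /andP[ast dst] sd sds.
have sd' : size d = len (wval d).
  by have := len_wval d; have := lengenM (wval d) a; rewrite -sd; lia.
have sds' : (size d <= len (wval d * gen s)%g)%N.
  by rewrite -ltnS (leq_trans sds)// -mulgA lengenM.
have dE := IH dst sd' sds'.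
have nxt : a = (if odd (size d) then s else t).
  case: (d) sd sds dE => [_|b d'] /=.
    rewrite mulg1 => + _; case/orP: ast => /eqP-> //.
    by rewrite genK len1.
  move=> sd _ [bE _]; have ab : a != b.
    by apply/eqP => ab; move: sd; rewrite ab mulKgen; have := len_wval d'; lia.
  move: ast ab; rewrite bE; case: (odd _) => /= /orP[]/eqP-> //; by rewrite eqxx.
by rewrite nxt -dE.
Qed.

Lemma dihedral_nonneg s t (d : seq S) : s != t -> all [pred x | (x == s) || (x == t)] d ->
  size d = len (wval d) -> (size d <= len (wval d * gen s)%g)%N ->
  exists a b : R, [/\ 0 <= a, 0 <= b & wact d (alpha s) = a *: alpha s + b *: alpha t].
Proof.
move=> st dst sd sds; have dE := dihedral_word dst sd sds; set k := size d in dE.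
(* With n = m(s, t) letters or more, the braid relation would rewrite the last n of them to end in
   [s], and right multiplication by [s] would shorten the word. *)
have kn : is_true (if m s t is Some n then k.+1 <= n else true)%N.
  case E : (m s t) => [n|//]; rewrite ltnNge; apply/negP => nk.
  have n0 := m_gt0 E.
  have [pre [sp aE]] := alt_cat s t (k - n) n; rewrite subnK// in aE.
  move: sd sds; rewrite -/k dE aE wval_cat (braid E); case: n {aE dE E} nk n0 sp => // n nk _ sp.
  have [l lE] : exists l, size l = n /\ wval (alt t s n.+1) = (wval l * gen s)%g.
    have [l [sl lE]] := alt_cat t s n 1; exists l; split => //.
    by rewrite -addn1 lE wval_cat /= mulg1.
  case: lE => sl ->; rewrite mulgA mulgenK -wval_cat => _.
  by have := len_wval (pre ++ l); rewrite size_cat sp sl; lia.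
have kn' : is_true (if m s t is Some n then k <= n else true)%N.
  by move: kn; case: (m s t) => // n /ltnW.
rewrite dE alt_alpha; case: (odd k).
  by exists (cheb (- cox s t) k), (cheb (- cox s t) k.+1); split=> //; exact: cheb_ge0.
by exists (cheb (- cox s t) k.+1), (cheb (- cox s t) k); split=> //; exact: cheb_ge0.
Qed.

Lemma nonnegD u v : nonneg u -> nonneg v -> nonneg (u + v).
Proof. by move=> hu hv t; rewrite VE addr_ge0. Qed.
Lemma nonnegZ a v : 0 <= a -> nonneg v -> nonneg (a *: v).
Proof. by move=> ha hv t; rewrite VE mulr_ge0. Qed.
Lemma nonneg_alpha s : nonneg (alpha s).
Proof. by move=> t; rewrite alphaE ler0n. Qed.

(* Humphreys, Reflection groups and Coxeter groups, Theorem 5.4: split off the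
   longest right factor of w lying in the dihedral subgroup of s and a right
   descent t of w, and compute in that subgroup. *)
Lemma act_alpha_nonneg (w : W) s : (len w <= len (w * gen s)%g)%N -> nonneg (act w (alpha s)).
Proof.
elim: {w}(len w).+1 {-2}w (ltnSn (len w)) s => // n IH w; rewrite ltnS => wn s ws.
have [->|w1] := eqVneq w 1%g; first by rewrite act1; exact: nonneg_alpha.
have [t wt] := len_descent w1.
have st : s != t by apply/eqP => st; move: ws; rewrite st; lia.
pose P k := `[< exists v d, [/\ w = (v * wval d)%g, all [pred x | (x == s) || (x == t)] d,
  (len v + size d)%N = len w & len v = k] >].
have Pt : P (len (w * gen t)%g).
  apply/asboolP; exists (w * gen t)%g, [:: t]; split=> //=.
  - by rewrite mulg1 mulgenK.
  - by rewrite eqxx orbT.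
  - by rewrite addn1 wt.
case: (ex_minnP (ex_intro P _ Pt)) => k /asboolP[v [d [wE dst vd vk]]] kmin.
have kw : (k <= len (w * gen t)%g)%N by exact: kmin.
have vmin x : (x == s) || (x == t) -> (len v <= len (v * gen x)%g)%N.
  move=> xst; rewrite leqNgt; apply/negP => lt.
  have : P (len (v * gen x)%g).
    apply/asboolP; exists (v * gen x)%g, (x :: d); split=> //=.
    - by rewrite mulgA mulgenK.
    - by rewrite xst.
    - have := lenMgen (v * gen x)%g x; rewrite mulgenK; lia.
  by move/kmin; lia.
have vn : (len v < n)%N by lia.
have pos x : (x == s) || (x == t) -> nonneg (act v (alpha x)).
  by move=> /vmin; apply: IH.
have sd : size d = len (wval d).
  by have := len_wval d; have := lenM v (wval d); rewrite -wE; lia.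
have sds : (size d <= len (wval d * gen s)%g)%N.
  have := lenM v (wval d * gen s)%g; rewrite mulgA -wE => /(leq_trans ws).
  by rewrite -vd leq_add2l.
have [a [b [a0 b0 E]]] := dihedral_nonneg st dst sd sds.
rewrite wE actM act_wval E actD !actZ.
by apply: nonnegD; apply: nonnegZ => //; apply: pos; rewrite eqxx ?orbT.
Qed.

Lemma act_alpha_nonpos (w : W) s : (len (w * gen s)%g < len w)%N -> nonpos (act w (alpha s)).
Proof.
move=> h t; have : nonneg (act (w * gen s)%g (alpha s)).
  by apply: act_alpha_nonneg; rewrite mulgenK ltnW.
by move/(_ t); rewrite actM act_gen sigma_alpha actN VE oppr_ge0.
Qed.

Definition isroot v := exists w s, v = act w (alpha s).

Lemma root_form v : isroot v -> form v v = 1.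
Proof. by move=> [w [s ->]]; rewrite act_form form_alpha coxss. Qed.

Lemma root_alpha s : isroot (alpha s).
Proof. by exists 1%g, s; rewrite act1. Qed.

Lemma root_act w v : isroot v -> isroot (act w v).
Proof. by move=> [x [s ->]]; exists (w * x)%g, s; rewrite actM. Qed.

Lemma root_sigma s v : isroot v -> isroot (sigma s v).
Proof. by rewrite -act_gen; exact: root_act. Qed.

Lemma rootN v : isroot v -> isroot (- v).
Proof.
by move=> [x [s ->]]; exists (x * gen s)%g, s; rewrite actM act_gen sigma_alpha actN.
Qed.

Lemma root_sign v : isroot v -> nonneg v \/ nonpos v.
Proof.
move=> [w [s ->]]; case: (leqP (len w) (len (w * gen s)%g)) => h.
  by left; exact: act_alpha_nonneg.
by right; exact: act_alpha_nonpos.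
Qed.

Definition pos v := isroot v /\ nonneg v.
Definition neg v := isroot v /\ nonpos v.

Lemma pos_neg v : pos v -> neg v -> False.
Proof.
move=> [rv v0] [_ v1]; have := root_form rv.
have -> : v = 0.
  by apply/ffunP => t; apply/eqP; rewrite eq_le zeroVE v0 v1.
by rewrite form0l => /eqP; rewrite eq_sym oner_eq0.
Qed.

Lemma posVneg v : isroot v -> pos v \/ neg v.
Proof. by move=> rv; case: (root_sign rv); [left|right]. Qed.

Lemma negN v : pos v -> neg (- v).
Proof. by move=> [rv v0]; split; [exact: rootN|move=> t; rewrite VE oppr_le0]. Qed.
Lemma posN v : neg v -> pos (- v).
Proof. by move=> [rv v0]; split; [exact: rootN|move=> t; rewrite VE oppr_ge0]. Qed.

Lemma pos_alpha s : pos (alpha s).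
Proof. by split; [exact: root_alpha|exact: nonneg_alpha]. Qed.

Lemma neg_descent (w : W) s : neg (act w (alpha s)) -> (len (w * gen s)%g < len w)%N.
Proof.
move=> h; rewrite ltnNge; apply/negP => /act_alpha_nonneg h'.
by apply: pos_neg h; split=> //; exists w, s.
Qed.

Lemma root_multiple c s : isroot (c *: alpha s) -> nonneg (c *: alpha s) -> c = 1.
Proof.
move=> /root_form + /(_ s); rewrite !formE form_alpha coxss VE alphaE eqxx !mulr1 => h c0.
have : (c - 1) * (c + 1) = 0 by lra.
move/eqP; rewrite mulf_eq0 subr_eq0 => /orP[/eqP//|]; rewrite addr_eq0 => /eqP c1.
by move: c0; rewrite c1 oppr_ge0 ler10.
Qed.

Lemma pos_coord v s : pos v -> v <> alpha s -> exists2 t, t != s & 0 < v t.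
Proof.
move=> [rv v0] vs; apply: contrapT => h.
have E t : t != s -> v t = 0.
  move=> ts; apply/eqP; rewrite eq_le v0 andbT leNgt; apply/negP => vt; apply: h.
  by exists t.
have vE : v = (v s : R) *: alpha s.
  apply/ffunP => t; rewrite VE alphaE; have [->|ts] := eqVneq t s; first by rewrite mulr1.
  by rewrite mulr0 E.
apply: vs; rewrite vE (@root_multiple (v s) s) ?scale1r -?vE//.
Qed.

Lemma pos_of_coord v t : isroot v -> 0 < v t -> pos v.
Proof.
by move=> rv vt; split=> //; case: (root_sign rv) => // /(_ t); rewrite leNgt vt.
Qed.

Lemma neg_of_coord v t : isroot v -> v t < 0 -> neg v.
Proof.
by move=> rv vt; split=> //; case: (root_sign rv) => // /(_ t); rewrite leNgt vt.
Qed.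

Lemma sigma_coord s v t : t != s -> sigma s v t = v t.
Proof. by move=> /negPf ts; rewrite /sigma !VE alphaE ts mulr0 subr0. Qed.

(** [sigma s] alters only the coordinate [s], and a positive root other than [alpha s] has another
    positive coordinate. *)
Lemma pos_sigma s v : pos v -> v <> alpha s -> pos (sigma s v).
Proof.
move=> pv vs; have [t ts vt] := pos_coord pv vs.
by apply: (@pos_of_coord _ t); [apply: root_sigma; case: pv|rewrite sigma_coord].
Qed.

Lemma cross_neg v t : neg v -> pos (sigma t v) -> v = - alpha t.
Proof.
move=> nv pv; apply: contrapT => h; apply: (pos_neg pv).
rewrite -[v]opprK -scaleN1r sigmaZ scaleN1r; apply: negN; apply: pos_sigma.
  exact: posN.
by move=> E; apply: h; rewrite -E opprK.
Qed.

Lemma alpha_inj : injective alpha.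
Proof.
move=> s t /(congr1 (fun v : V => v s)); rewrite !alphaE eqxx.
by case: eqP => // _ /eqP; rewrite oner_eq0.
Qed.

Lemma neg_descent_ex (w : W) : w != 1%g -> exists t, neg (act w (alpha t)).
Proof.
move=> /len_descent[t wt]; exists t; split; first exact: root_act (root_alpha t).
by apply: act_alpha_nonpos; rewrite wt.
Qed.

Lemma act_id (w : W) : (forall s, act w (alpha s) = alpha s) -> w = 1%g.
Proof.
move=> h; apply/eqP; case: (eqVneq w 1%g) => // w1; have [t wt] := len_descent w1.
have : nonpos (act w (alpha t)) by apply: act_alpha_nonpos; rewrite wt.
by rewrite h => /(_ t); rewrite alphaE eqxx ler10.
Qed.

Lemma act_faithful (x y : W) : (forall s, act x (alpha s) = act y (alpha s)) -> x = y.
Proof.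
move=> h; apply: (mulgI x^-1%g); rewrite mulVg; apply/esym/act_id => s.
by rewrite actM -h actK.
Qed.

(** * Walls and distances *)

Lemma act_reflection (x : W) s v (c := act x (alpha s)) :
  act (x * gen s * x^-1)%g v = v - (2 * form v c) *: c.
Proof.
rewrite !actM act_gen /sigma actD actN actZ actVK; congr (_ - (2 * _) *: _).
by rewrite -(act_form x) actVK.
Qed.

Lemma reflection_eq (x y : W) s t :
  act x (alpha s) = act y (alpha t) \/ act x (alpha s) = - act y (alpha t) ->
  (x * gen s * x^-1 = y * gen t * y^-1)%g.
Proof.
move=> h; apply: act_faithful => r; rewrite !act_reflection.
case: h => -> //; rewrite formNr mulrN scaleNr scalerN opprK //.
Qed.

Lemma act_reflection_root (x : W) s :
  act (x * gen s * x^-1)%g (act x (alpha s)) = - act x (alpha s).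
Proof. by rewrite !actM actK act_gen sigma_alpha actN. Qed.

Lemma reflection_root (x y : W) s t :
  (x * gen s * x^-1 = y * gen t * y^-1)%g ->
  act x (alpha s) = act y (alpha t) \/ act x (alpha s) = - act y (alpha t).
Proof.
move=> E; have := act_reflection_root x s; rewrite E act_reflection.
set a := act x _; set b := act y _; set c := form a b => h.
have aE : a = c *: b.
  apply/ffunP => r; move: (congr1 (fun v : V => v r) h); rewrite !VE; lra.
have : c * c = 1.
  have := root_form (root_act x (root_alpha s)); rewrite -/a {1}aE formZl formC -/c //.
move=> /(congr1 (fun z => z - 1)); rewrite subrr => cc.
have : (c - 1) * (c + 1) = 0 by rewrite -cc; ring.
move/eqP; rewrite mulf_eq0 subr_eq0 addr_eq0 => /orP[] /eqP cE; [left|right].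
  by rewrite aE cE scale1r.
by rewrite aE cE scaleN1r.
Qed.

(** For a reduced word these are the positive roots of the walls separating 1 from [wval u], in the
    order in which the word crosses them. *)
Fixpoint invs (u : seq S) : seq V :=
  if u is s :: u' then alpha s :: map (sigma s) (invs u') else [::].

Lemma size_invs u : size (invs u) = size u.
Proof. by elim: u => //= s u; rewrite size_map => ->. Qed.

Lemma invs_cat u1 u2 : invs (u1 ++ u2) = invs u1 ++ map (act (wval u1)) (invs u2).
Proof.
elim: u1 => [|s u1 IH] /=.
  by rewrite (@eq_map _ _ _ id) ?map_id// => v; rewrite act1.
rewrite IH map_cat -map_comp; congr (_ :: _ ++ _).
by apply: eq_map => v /=; rewrite actM act_gen.
Qed.

Lemma mem_invs u v : pos v -> neg (act (wval u)^-1%g v) -> v \in invs u.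
Proof.
elim: u v => [|s u IH] v pv /=; first by rewrite invg1 act1 => /(pos_neg pv).
rewrite invgM genV actM act_gen in_cons; have [//|/eqP vs] := eqVneq v (alpha s).
move=> h /=; rewrite -(sigmaK s v); apply: map_f; apply: IH => //.
exact: pos_sigma.
Qed.

Lemma reduced_cons s u : size (s :: u) = len (wval (s :: u)) -> size u = len (wval u).
Proof. by move=> /= E; have := len_wval u; have := lengenM (wval u) s; rewrite -E; lia. Qed.

Lemma reduced_invs u v : size u = len (wval u) -> v \in invs u ->
  pos v /\ neg (act (wval u)^-1%g v).
Proof.
elim: u v => //= s u IH v red; have red' := reduced_cons red.
have ps : pos (act (wval u)^-1%g (alpha s)).
  split; first exact: root_act (root_alpha s).
  apply: act_alpha_nonneg; rewrite -[(_ * _)%g]invgK invgM genV invgK !lenV.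
  by rewrite -red -red'.
rewrite in_cons invgM genV => /orP[/eqP->|/mapP[w /(IH _ red')[pw nw] ->]].
  by split; [exact: pos_alpha|rewrite actM act_gen sigma_alpha actN; exact: negN].
split; last by rewrite actM act_gen sigmaK.
by apply: pos_sigma => // ws; rewrite ws in nw; exact: pos_neg nw.
Qed.

Lemma reduced_uniq u : size u = len (wval u) -> uniq (invs u).
Proof.
elim: u => //= s u IH red; have red' := reduced_cons red.
rewrite (map_inj_uniq (can_inj (sigmaK s))) IH// andbT; apply/mapP => -[w].
move=> /(reduced_invs red')[pw _] /(congr1 (sigma s)); rewrite sigmaK sigma_alpha => wE.
by apply: pos_neg pw _; rewrite -wE; exact: negN (pos_alpha s).
Qed.

Lemma inversions_le (w : W) (D : seq V) : uniq D ->
  (forall v, v \in D -> pos v /\ neg (act w^-1%g v)) -> (size D <= len w)%N.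
Proof.
have [u <- <-] := lenP w; move=> uD h; rewrite -size_invs; apply: uniq_leq_size => //.
by move=> v /h[]; exact: mem_invs.
Qed.

Lemma finite_inversions (w : W) : exists L : seq V, forall v, pos v -> neg (act w v) -> v \in L.
Proof.
have [u uE] := wval_surj w^-1%g; exists (invs u) => v pv nv.
by apply: mem_invs => //; rewrite uE invgK.
Qed.

(* [u] lies on a geodesic from [x] to [y]: it belongs to every half-space
   containing [x] and [y]. *)
Definition betw (x u y : W) := forall v,
  neg (act x^-1%g v) -> neg (act y^-1%g v) -> neg (act u^-1%g v).

Lemma betw_pos (x u y : W) v : betw x u y ->
  pos (act x^-1%g v) -> pos (act y^-1%g v) -> pos (act u^-1%g v).
Proof.
move=> b /negN px /negN py; rewrite -[act _ v]opprK; apply: posN.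
by rewrite -actN; apply: b; rewrite actN.
Qed.

Lemma root_of_act (x : W) v : isroot (act x v) -> isroot v.
Proof. by move=> h; rewrite -(actK x v); exact: root_act. Qed.

Lemma pos_contra v : isroot v -> (neg v -> False) -> pos v.
Proof. by move=> /posVneg[]. Qed.

Lemma neg_contra v : isroot v -> (pos v -> False) -> neg v.
Proof. by move=> /posVneg[]. Qed.

(** Length counts separating walls. Betweenness makes the walls between x and u and those between u
    and y distinct and all separating x from y. Conversely, when lengths add up, [ua ++ ub] is
    reduced, and a wall cutting off u alone would be an inversion of [ua] but not of [ua ++ ub]. *)
Lemma betw_len (x u y : W) : betw x u y <->
  (len (x^-1 * u)%g + len (u^-1 * y)%g)%N = len (x^-1 * y)%g.
Proof.
set a := (x^-1 * u)%g; set b := (u^-1 * y)%g.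
have abE : (x^-1 * y)%g = (a * b)%g by rewrite /a /b mulgA mulgK.
have aE v : act a^-1%g v = act u^-1%g (act x v) by rewrite /a invgM invgK actM.
have abVE v : act (a * b)^-1%g v = act y^-1%g (act x v).
  by rewrite -abE invgM invgK actM.
have bE v : act b^-1%g v = act y^-1%g (act u v) by rewrite /b invgM invgK actM.
rewrite abE; have [ua ua_a sa] := lenP a; have [ub ub_b sb] := lenP b.
split=> [bt|E v nx ny].
  apply/eqP; rewrite eqn_leq lenM andbT -sa -sb -size_cat -size_invs invs_cat.
  have reda : size ua = len (wval ua) by rewrite ua_a.
  have redb : size ub = len (wval ub) by rewrite ub_b.
  rewrite ua_a; apply: inversions_le.
    rewrite cat_uniq reduced_uniq// (map_inj_uniq (@act_inj a)) reduced_uniq// andbT.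
    apply/hasP => -[v /mapP[w /(reduced_invs redb)[pw _] ->] /(reduced_invs reda)[_]].
    by rewrite ua_a actK; exact: pos_neg pw.
  move=> v; rewrite mem_cat => /orP[/(reduced_invs reda)|/mapP[w /(reduced_invs redb)]].
    rewrite ua_a aE abVE => -[pv nv]; split=> //.
    apply: neg_contra => [|py]; first by do 2!apply: root_act; case: pv.
    by apply: pos_neg nv; apply: (betw_pos bt) => //; rewrite actK.
  rewrite ub_b bE => -[pw nw] ->; rewrite abVE.
  have E : act x (act a w) = act u w by rewrite /a actM actVK.
  rewrite E; split=> //; apply: pos_contra => [|naw]; first by apply: root_act; case: pw.
  have : neg (act u^-1%g (act u w)).
    by apply: bt => //; rewrite -E actK.
  by rewrite actK; exact: pos_neg pw.
have rv : isroot v by apply: (@root_of_act x^-1%g); case: nx.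
apply: neg_contra => [|pu]; first exact: root_act.
have pd : pos (act x^-1%g (- v)) by rewrite actN; exact: posN.
have red : size (ua ++ ub) = len (wval (ua ++ ub)).
  by rewrite wval_cat ua_a ub_b size_cat sa sb.
have : act x^-1%g (- v) \in invs (ua ++ ub).
  rewrite invs_cat mem_cat mem_invs// ua_a aE actVK actN; exact: negN.
move=> /(reduced_invs red)[_]; rewrite wval_cat ua_a ub_b abVE actVK actN.
by apply: pos_neg; exact: posN.
Qed.

(** * The path metric as word length *)

Lemma path_adjacent (x : W) p : path (adjacent gen) x p ->
  exists u, size u = size p /\ (x * wval u)%g = last x p.
Proof.
elim: p x => [|y p IH] x /=; first by exists [::]; rewrite mulg1.
move=> /andP[/existsP[s /eqP->]] /IH[u [su uE]].
by exists (s :: u); rewrite /= su mulgA.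
Qed.

Lemma adjacent_path (x : W) u :
  exists p, [/\ path (adjacent gen) x p, last x p = (x * wval u)%g & size p = size u].
Proof.
elim: u x => [|s u IH] x; first by exists [::]; rewrite mulg1.
have [p [pp pl ps]] := IH (x * gen s)%g; exists ((x * gen s)%g :: p); split=> /=.
- by rewrite pp andbT; apply/existsP; exists s.
- by rewrite pl mulgA.
- by rewrite ps.
Qed.

Lemma distE (x y : W) : dist gen x y = len (x^-1 * y)%g.
Proof.
have j1 : joined_in gen x y (len (x^-1 * y)%g).
  have [u uE <-] := lenP (x^-1 * y)%g; have [p [pp pl ps]] := adjacent_path x u.
  by exists p; rewrite pl uE mulVKg.
have j2 n : joined_in gen x y n -> (len (x^-1 * y)%g <= n)%N.
  move=> [p [/path_adjacent[u [su uE]] pl <-]].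
  by rewrite -pl -uE mulKg -su len_wval.
rewrite /dist; case: xgetP => [n _ [jn nmin]|/(_ (len (x^-1 * y)%g))[]].
  by apply/eqP; rewrite eqn_leq nmin ?j2.
by split.
Qed.

(** * Values of the form on pairs of roots *)

Lemma root_reflection v : isroot v ->
  exists r : W, forall u, act r u = u - (2 * form u v) *: v.
Proof.
by move=> [x [s ->]]; exists (x * gen s * x^-1)%g => u; rewrite act_reflection.
Qed.

Lemma act_neg_combination (g : W) u v (c : R) : neg (act g u) -> neg (act g v) -> 0 <= c ->
  isroot (u + c *: v) -> neg (act g (u + c *: v)).
Proof.
move=> [_ nu] [_ nv] c0 rw; split; first exact: root_act.
move=> t; rewrite actD actZ !VE; have := nu t; have := nv t => nvt nut.
by rewrite -oppr_ge0 opprD addr_ge0 ?oppr_ge0// mulr_ge0_le0.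
Qed.

(* Descent along a word for [g]: when the next letter is the reflection r_a in
   the simple root [a], the pair (a, b) is replaced by (r_a b, b), on which the
   form is 1 - 2 B(a, b)^2 <= -1. *)
Lemma quadrant (g : W) a b : pos a -> pos b -> form a b <= -1 ->
  neg (act g a) -> neg (act g b) -> False.
Proof.
have [u <-] := wval_surj g; elim/last_ind: u a b => [|u s IH] a b pa pb ab.
  by rewrite act1 => /(pos_neg pa).
have aE v : act (wval (rcons u s)) v = act (wval u) (sigma s v).
  by rewrite -cats1 wval_cat actM /= mulg1 act_gen.
have main b' : pos b' -> form b' (alpha s) <= -1 -> neg (act (wval (rcons u s)) (alpha s)) ->
    neg (act (wval (rcons u s)) b') -> False.
  move=> pb' ab' na nb.
  have bs : b' <> alpha s by move=> E; move: ab'; rewrite E form_alpha coxss; lra.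
  have psb : pos (sigma s b') by exact: pos_sigma.
  apply: (IH b' (sigma s b')) => //.
  - rewrite /sigma !formE root_form//; last by case: pb'.
    have : 1 <= form b' (alpha s) * form b' (alpha s).
      by rewrite -mulrNN -[1]mulr1 ler_pM//; lra.
    by lra.
  - have -> : b' = sigma s (sigma s b') by rewrite sigmaK.
    rewrite -aE /sigma -scaleNr; apply: act_neg_combination => //; first lra.
    by rewrite scaleNr; case: psb.
  - by rewrite -aE.
have [E|/eqP bs] := eqVneq b (alpha s).
  by rewrite E in ab * => na nb; exact: (main a).
have [E|/eqP sa] := eqVneq a (alpha s).
  by rewrite E formC in ab; rewrite E => na nb; exact: (main b).
rewrite !aE; apply: IH; rewrite ?form_sigma//; exact: pos_sigma.
Qed.

Definition linear_form (f : V -> R) :=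
  (forall u v, f (u + v) = f u + f v) /\ (forall a v, f (a *: v) = a * f v).

Lemma linear_form_act (f : V -> R) (w : W) : linear_form f -> linear_form (f \o act w).
Proof. by case=> fD fZ; split=> *; rewrite /= ?actD ?actZ ?fD ?fZ. Qed.

Lemma linear_formN (f : V -> R) v : linear_form f -> f (- v) = - f v.
Proof. by case=> _ fZ; rewrite -scaleN1r fZ mulN1r. Qed.

Lemma linear_form0 (f : V -> R) : linear_form f -> f 0 = 0.
Proof. by case=> _ fZ; rewrite -(scale0r 0) fZ mul0r. Qed.

Lemma linear_form_expand (f : V -> R) v : linear_form f ->
  f v = \sum_t (v t : R) * f (alpha t).
Proof.
move=> fl; case: (fl) => fD fZ; rewrite {1}(vec_expand v) (big_morph f fD (linear_form0 fl)).
by apply: eq_bigr => t _; rewrite fZ.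
Qed.

Definition height (v : V) : R := \sum_t (v t : R).

Lemma linear_height : linear_form height.
Proof.
split=> [u v|a v]; rewrite /height.
  by rewrite -big_split; apply: eq_bigr => t _; rewrite VE.
by rewrite big_distrr; apply: eq_bigr => t _; rewrite VE.
Qed.

Lemma height_gt0 v : pos v -> 0 < height v.
Proof.
move=> [rv v0]; rewrite lt0r sumr_ge0// andbT; apply/eqP => h.
have vE : v = 0.
  by apply/ffunP => t; rewrite zeroVE; apply: (psumr_eq0P _ h).
by have := root_form rv; rewrite vE form0l => /eqP; rewrite eq_sym oner_eq0.
Qed.

(* The roots a and b span a plane on which g = (r_a r_b)^(2^n) satisfies
   g^2 - 2 c g + 1 = 0; doubling the angle makes c nonpositive. *)
Lemma rotation_doubling n (c : R) (g : W) a b : 1 <= (1 - c) * 2 ^+ n ->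
  (forall v, v = a \/ v = b -> act g (act g v) = (2 * c) *: act g v - v) ->
  exists (c' : R) (h : W), c' <= 0 /\
    (forall v, v = a \/ v = b -> act h (act h v) = (2 * c') *: act h v - v).
Proof.
elim: n c g => [|n IH] c g h gE; first by exists c, g; split=> //; lra.
have [c0|c0] := leP c 0; first by exists c, g.
have c1 : 0 < 1 - c.
  by rewrite -(pmulr_lgt0 _ (exprn_gt0 n.+1 (ltr0n R 2))); apply: lt_le_trans h.
apply: (IH (2 * c ^+ 2 - 1) (g * g)%g).
  have p0 : 0 < 2 ^+ n :> R by rewrite exprn_gt0.
  move: h; rewrite exprS; set p := 2 ^+ n in p0 *; have := mulr_gt0 (mulr_gt0 p0 c1) c0.
  lra.
move=> v /gE E; rewrite !actM E !(actD, actN, actZ) E !(actD, actN, actZ) E.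
by apply/ffunP => t; rewrite !VE; ring.
Qed.

(** [f] is [height] composed with 1 - 2 c g + g^2, which vanishes on the plane of [a] and [b]. As
    [c] is nonpositive, no term is negative on a positive root that neither g nor g^2 inverts, and
    only finitely many roots are inverted. *)
Lemma plane_functional a b : isroot a -> isroot b -> -1 < form a b < 1 ->
  exists f, [/\ linear_form f, f a = 0, f b = 0 &
    exists L : seq V, forall v, pos v -> v \notin L -> 0 < f v].
Proof.
move=> ra rb /andP[B1 B2]; set B := form a b in B1 B2.
have [x xE] := root_reflection ra; have [y yE] := root_reflection rb.
(* The product of the two reflections turns the plane by twice the angle with cosine [B], whence the
   cosine [2 * B ^+ 2 - 1]. *)
have c1 : 0 < 1 - (2 * B ^+ 2 - 1) by nra.
have [n nE] : exists n, 1 <= (1 - (2 * B ^+ 2 - 1)) * 2 ^+ n :> R.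
  set e := 1 - _ in c1 *.
  have [k /ltW ke] : exists k : nat, e^-1 < k%:R.
    by exists (Num.bound e^-1); apply: archi_boundP; rewrite invr_ge0 ltW.
  exists k; move: ke; rewrite -(ler_pM2l c1) mulfV ?lt0r_neq0// => /le_trans; apply.
  by rewrite ler_pM2l// -natrX ler_nat ltnW// ltn_expl.
have gE v : v = a \/ v = b ->
    act (x * y)%g (act (x * y)%g v) = (2 * (2 * B ^+ 2 - 1)) *: act (x * y)%g v - v.
  have fa := root_form ra; have fb := root_form rb.
  by case=> ->; rewrite !actM !(xE, yE) !formE ?fa ?fb ?(formC b a) -/B;
     apply/ffunP => t; rewrite !VE; ring.
have [c [g [c0 hE]]] := rotation_doubling nE gE.
have [hD hZ] := linear_height.
pose f v := height v + (- 2 * c) * height (act g v) + height (act g (act g v)).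
have fl : linear_form f by split=> *; rewrite /f ?actD ?actZ ?hD ?hZ ?actZ ?hZ; ring.
have f0 v : v = a \/ v = b -> f v = 0.
  by move=> hv; rewrite /f hE// hD hZ (linear_formN _ linear_height); ring.
exists f; split; [by []|by apply: f0; left|by apply: f0; right|].
have [L1 L1P] := finite_inversions g; have [L2 L2P] := finite_inversions (g * g)%g.
exists (L1 ++ L2) => v pv; rewrite mem_cat negb_or => /andP[v1 v2].
have p1 : pos (act g v).
  by apply: pos_contra => [|/L1P]; [apply: root_act; case: pv|move/(_ pv); exact/negP].
have p2 : pos (act g (act g v)).
  rewrite -actM; apply: pos_contra => [|/L2P]; first by apply: root_act; case: pv.
  by move/(_ pv); exact/negP.
have := height_gt0 pv; have := height_gt0 p1; have := height_gt0 p2.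
have c2 : 0 <= - 2 * c by lra.
by rewrite /f => h2 h1 h0; rewrite addr_gt0// ltr_wpDr// mulr_ge0// ltW.
Qed.

(** A simple reflection permutes the positive roots other than its own. Reflecting in a simple root
    where [f] is negative thus removes one root from the list of negative values. *)
Lemma move_to_chamber n (f : V -> R) (L : seq V) : linear_form f -> (size L <= n)%N ->
  (forall v, pos v -> f v < 0 -> v \in L) ->
  exists w, forall t, 0 <= f (act w (alpha t)).
Proof.
elim: n f L => [|n IH] f L fl sL hL.
  exists 1%g => t; rewrite act1 leNgt; apply/negP => /(hL _ (pos_alpha t)).
  by move: sL; rewrite leqn0 => /nilP->.
case: (pselect (exists t, f (alpha t) < 0)) => [[t ft]|h]; last first.
  by exists 1%g => t; rewrite act1 leNgt; apply/negP => ft; apply: h; exists t.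
have [|||w wE] := IH (f \o act (gen t)) [seq sigma t v | v <- L & v != alpha t].
- exact: linear_form_act.
- rewrite size_map -ltnS; apply: leq_trans sL.
  rewrite size_filter -(count_predC (pred1 (alpha t)) L) -[X in (X < _)%N]add0n ltn_add2r.
  by rewrite -has_count has_pred1 hL//; exact: pos_alpha.
- move=> v pv; rewrite /= act_gen => fv.
  have vt : v <> alpha t.
    by move=> E; move: fv; rewrite E sigma_alpha linear_formN//; lra.
  rewrite -[v](sigmaK t); apply: map_f; rewrite mem_filter (hL _ (pos_sigma pv vt) fv) andbT.
  apply/eqP => E; apply: (pos_neg pv); rewrite -[v](sigmaK t) E sigma_alpha.
  exact: negN (pos_alpha t).
by exists (gen t * w)%g => r; rewrite actM; exact: wE.
Qed.

Definition supported (J : {set S}) (v : V) := forall t, t \notin J -> v t = 0.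

(** The coordinates of a root have one sign, so the expansion of [f v] vanishes term by term. *)
Lemma root_supported (f : V -> R) v : linear_form f -> (forall t, 0 <= f (alpha t)) -> isroot v ->
  f v = 0 -> supported [set t | f (alpha t) == 0] v.
Proof.
move=> fl f0; wlog pv : v / pos v => [H rv fv|].
  case: (posVneg rv) => [pv|/posN pv]; first exact: H.
  have := H _ pv (rootN rv); rewrite linear_formN// fv oppr0 => /(_ erefl) h t /h.
  by rewrite VE => /eqP; rewrite oppr_eq0 => /eqP.
move=> _; rewrite (linear_form_expand _ fl) => h t; rewrite inE => /negP ft.
have vf : (v t : R) * f (alpha t) = 0.
  by apply: (psumr_eq0P _ h) => // r _; rewrite mulr_ge0// ; case: pv.
by move/eqP: vf; rewrite mulf_eq0 => /orP[/eqP//|/ft].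
Qed.

(* The pair (a, b) is conjugate to a pair of roots of a standard parabolic
   subgroup with finitely many roots. *)
Lemma finite_form_values : exists F : seq R, forall a b, isroot a -> isroot b ->
  -1 < form a b < 1 -> form a b \in F.
Proof.
pose finite J (L : seq V) := forall v, pos v -> supported J v -> v \in L.
(* The lists are fixed before [a] and [b]; for a [J] with infinitely many positive roots the list is
   arbitrary. *)
have [Lf LfP] : {Lf & forall J, (exists L, finite J L) -> finite J (Lf J)}.
  apply: (@boolp.choice _ _ (fun J L => (exists L, finite J L) -> finite J L)) => J.
  by case: (pselect (exists L, finite J L)) => [[L LP]|h]; [exists L|exists [::]].
pose Lpm J := Lf J ++ [seq - v | v <- Lf J].
exists (flatten [seq [seq form u v | u <- Lpm J, v <- Lpm J] | J <- enum {set S}]).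
move=> a b ra rb hB.
have [f [fl fa fb [L LP]]] := plane_functional ra rb hB.
have [w wE] : exists w, forall t, 0 <= f (act w (alpha t)).
  apply: (move_to_chamber fl (leqnn (size L))) => v pv fv.
  by apply/negPn/negP => /(LP _ pv); lra.
pose J := [set t | (f \o act w) (alpha t) == 0].
have fwl : linear_form (f \o act w) by exact: linear_form_act.
have sup v : isroot v -> f v = 0 -> supported J (act w^-1%g v).
  by move=> rv fv; apply: root_supported => //; [exact: root_act|rewrite /= actVK].
have [L2 L2P] := finite_inversions w.
(* [f] vanishes at [act w v] for [v] supported on [J]; so [act w v] is negative, an inversion of
   [w], or one of the exceptional roots in [L]. *)
have JP : exists L, finite J L.
  exists ([seq act w^-1%g v | v <- L] ++ L2) => v pv sv; rewrite mem_cat.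
  have fv : f (act w v) = 0.
    have := linear_form_expand v fwl; rewrite /= => ->; apply: big1 => t _.
    case: (boolP (t \in J)) => [|/sv->]; last by rewrite mul0r.
    by rewrite inE => /eqP /= ->; rewrite mulr0.
  case: (posVneg (root_act w (proj1 pv))) => [pw|/(L2P _ pv) ->]; last by rewrite orbT.
  apply/orP; left; rewrite -[v](actK w); apply: map_f.
  by apply/negPn/negP => /(LP _ pw); rewrite fv ltxx.
have memL v : isroot v -> supported J v -> v \in Lpm J.
  move=> rv sv; rewrite mem_cat; case: (posVneg rv) => [pv|/posN pv].
    by rewrite (LfP _ JP).
  apply/orP; right; rewrite -[v]opprK; apply: map_f; apply: (LfP _ JP) => // t /sv.
  by rewrite VE => ->; rewrite oppr0.
apply/flattenP; exists [seq form u v | u <- Lpm J, v <- Lpm J].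
  by apply: map_f; rewrite mem_enum.
rewrite -(act_form w^-1%g); apply: allpairs_f; apply: memL; by [exact: root_act|exact: sup].
Qed.

(** * The parallel wall theorem *)

Lemma form_sigma_alpha s v : form (sigma s v) (alpha s) = - form v (alpha s).
Proof. by rewrite /sigma !formE form_alpha coxss; ring. Qed.

Lemma form_sigma_le s t v : t != s -> form v (alpha s) <= 0 ->
  form (sigma s v) (alpha t) <= form v (alpha t).
Proof.
move=> ts vs; rewrite /sigma !formE form_alpha.
have st : s != t by rewrite eq_sym.
have := mulr_le0 vs (cox_le0 st); lra.
Qed.

(** * Runs of steps with form values strictly between -1 and 0 *)

Section Run.

Variables (c : nat -> V) (s : nat -> S) (n : nat).
Hypothesis c_step : forall j, (j < n)%N -> c j.+1 = sigma (s j) (c j).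
Hypothesis c_pos : forall j, (j <= n)%N -> pos (c j).
Hypothesis c_form : forall j, (j < n)%N -> -1 < form (c j) (alpha (s j)) < 0.

(** Steps other than [t] can only lower the value on [alpha t], which still exceeds -1 when [t] is
    next used. *)
Lemma run_before t d i : (i + d < n)%N -> s (i + d)%N = t -> -1 < form (c i) (alpha t).
Proof.
elim: d i => [|d IH] i; rewrite ?addn0 => idn; first by move=> <-; case/andP: (c_form idn).
have i_n : (i < n)%N by lia.
rewrite addnS -addSn => st; have [<-|ts] := eqVneq (s i) t.
  by case/andP: (c_form i_n).
apply: lt_le_trans (IH i.+1 _ st) _; first by rewrite addSn -addnS.
rewrite c_step//; apply: form_sigma_le; first by rewrite eq_sym.
by case/andP: (c_form i_n) => _ /ltW.
Qed.

(** Using [t] flips a value in (-1, 0) to one in (0, 1); until the next use of [t] it can only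
    decrease. *)
Lemma run_after t d k : (k + d < n)%N -> s k = t -> form (c (k + d).+1) (alpha t) < 1.
Proof.
move=> + skt; elim: d => [|d IH] kdn.
  move: kdn; rewrite addn0 => kn; rewrite c_step// -skt form_sigma_alpha.
  by case/andP: (c_form kn); lra.
have kn : (k + d.+1 < n)%N by lia.
rewrite c_step//; case/andP: (c_form kn) => h1 h2; have [<-|ts] := eqVneq (s (k + d.+1)%N) t.
  by rewrite form_sigma_alpha; lra.
apply: (le_lt_trans (@form_sigma_le _ t _ _ _)); [by rewrite eq_sym|exact: ltW|].
by rewrite addnS; apply: IH; lia.
Qed.

Lemma run_coord t i j : (i <= j)%N -> (j <= n)%N -> c i t <= c j t.
Proof.
move=> ij; rewrite -(subnKC ij); elim: (j - i)%N => [|d IH] h; first by rewrite addn0.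
have dn : (i + d < n)%N by lia.
apply: (le_trans (IH (ltnW dn))); rewrite addnS c_step// /sigma !VE lerDl -mulNr.
rewrite mulr_ge0 ?alphaE ?ler0n//; case/andP: (c_form dn); lra.
Qed.

(** Pairs of roots take finitely many values in (-1, 1), so clipping leaves a finite state space. *)
Definition clip (x : R) : R := if x <= -1 then -1 else if 1 <= x then 1 else x.

(* If the state recurs, [c i] can be translated backwards along [delta]
   indefinitely through roots with the same steps; such a step never turns a
   negative root into a positive one, since that needs the value -1. *)
Lemma run_no_recurrence i j : (i < j)%N -> (j <= n)%N ->
  (forall t, clip (form (c i) (alpha t)) = clip (form (c j) (alpha t))) -> False.
Proof.
move=> ij jn ccE; set delta : V := c j - c i.
(* The value at [c i] is above -1 and the one at [c j] below 1; equal clipped values are then equal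
   values. *)
have used k : (i <= k < j)%N -> form delta (alpha (s k)) = 0.
  move=> /andP[ik kj].
  have h1 : -1 < form (c i) (alpha (s k)).
    by apply: (@run_before _ (k - i)); rewrite subnKC//; lia.
  have h2 : form (c j) (alpha (s k)) < 1.
    have -> : j = (k + (j - k.+1)).+1 by lia.
    by apply: run_after => //; lia.
  have := ccE (s k); rewrite /delta !formE /clip; move: h1 h2.
  move: (form (c i) _) (form (c j) _) => x y.
  by case: (leP x (-1)); case: (leP 1 x); case: (leP y (-1)); case: (leP 1 y); lra.
have step k p : (i <= k < j)%N ->
    sigma (s k) (c k.+1 - p *: delta) = c k - p *: delta.
  move=> ikj; rewrite c_step; last by lia.
  rewrite sigmaD sigmaK -scaleN1r !sigmaZ sigma_orth//; exact: used.
(* Induction on [p], and inside it downwards on [k] from [j], where [c j] shifted by [p.+1] is [c i]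
   shifted by [p]. *)
have back p : (forall k, (i <= k <= j)%N -> pos (c k - p%:R *: delta)).
  elim: p => [|p IH] k.
    by move=> ikj; rewrite scale0r subr0; apply: c_pos; lia.
  move=> /andP[ik kj]; rewrite -(subKn kj).
  have : (j - k <= j - i)%N by lia.
  elim: (j - k)%N => [|d IHd] dji.
    rewrite subn0 (_ : _ - _ = c i - p%:R *: delta); first by apply: IH; lia.
    by apply/ffunP => t; rewrite /delta mulrS !VE; ring.
  have E : (j - d = (j - d.+1).+1)%N by lia.
  have hk : (i <= j - d.+1 < j)%N by lia.
  rewrite -step//; apply: pos_sigma; rewrite -E; first by apply: IHd; lia.
  rewrite E => h; have := step _ p.+1%:R hk; rewrite h sigma_alpha => h2.
  have : form (c (j - d.+1)%N - p.+1%:R *: delta) (alpha (s (j - d.+1)%N)) = -1.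
    by rewrite -h2 formNl form_alpha coxss.
  have jdn : (j - d.+1 < n)%N by lia.
  by have := c_form jdn; rewrite formDl formNl formZl used//; lra.
(* The step at [i] raises the coordinate [s i] and no later step lowers it, so subtracting [delta]
   often enough makes it negative. *)
have d0 : 0 < delta (s i).
  have i_n : (i < n)%N by lia.
  have := run_coord (s i) ij jn; rewrite c_step// /delta /sigma !VE alphaE eqxx mulr1.
  case/andP: (c_form i_n) => _; set x := form _ _; set y := c j _; set z := c i _.
  by move=> h1 h2; rewrite subr_gt0; apply: lt_le_trans h2; rewrite ltrDl; lra.
have [p pE] : exists p : nat, c i (s i) < p%:R * delta (s i).
  exists (Num.bound (c i (s i) / delta (s i))); rewrite -ltr_pdivrMr//.
  apply: archi_boundP; rewrite divr_ge0// ?(ltW d0)//.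
  by case: (c_pos (ltnW (leq_trans ij jn))) => _; apply.
have iij : (i <= i <= j)%N by rewrite leqnn ltnW.
by have [_ /(_ (s i))] := back p i iij; rewrite addVE oppVE scaleVE subr_ge0 leNgt pE.
Qed.

End Run.

(** Pigeonhole: a run of [n] steps visits [n + 1] clipped states, and none may recur. *)
Lemma run_bound : exists N, forall (c : nat -> V) (s : nat -> S) n,
  (forall j, (j < n)%N -> c j.+1 = sigma (s j) (c j)) ->
  (forall j, (j <= n)%N -> pos (c j)) ->
  (forall j, (j < n)%N -> -1 < form (c j) (alpha (s j)) < 0) -> (n < N)%N.
Proof.
have [F FP] := finite_form_values; pose F2 := [:: -1, 1 & F].
exists #|{ffun S -> 'I_(size F2).+1}| => c s n c_step c_pos c_form.
rewrite ltnNge; apply/negP => nN.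
pose st (j : 'I_n.+1) : {ffun S -> 'I_(size F2).+1} :=
  [ffun t => inord (index (clip (form (c j) (alpha t))) F2)].
have F2P (j : 'I_n.+1) t : clip (form (c j) (alpha t)) \in F2.
  rewrite /clip !inE; case: ifP => [_|h1]; first by rewrite eqxx.
  case: ifP => [_|h2]; first by rewrite eqxx orbT.
  rewrite FP ?orbT//; first by case: (c_pos j); rewrite // -ltnS.
    exact: root_alpha.
  by rewrite !ltNge h1 h2.
have : ~~ injectiveb st.
  apply/injectiveP => /leq_card; rewrite card_ord => /leq_trans /(_ nN).
  by rewrite ltnn.
move=> /injectivePn[i [j ij stE]].
have cE t : clip (form (c i) (alpha t)) = clip (form (c j) (alpha t)).
  have := congr1 (fun f : {ffun S -> _} => nat_of_ord (f t)) stE; rewrite !ffunE.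
  rewrite !inordK ?ltnS ?index_size// => /(congr1 (nth 0 F2)).
  by rewrite !nth_index.
wlog lij : i j ij cE {stE} / (i < j)%N.
  move=> H; have := ij; rewrite -val_eqE neq_ltn => /orP[lij|lji]; first exact: (H i j).
  by apply: (H j i) => //; rewrite eq_sym.
by apply: (run_no_recurrence c_step c_pos c_form lij _ cE); rewrite -ltnS.
Qed.

(** * Chains of simple reflections that increase a root *)

Fixpoint up (v : V) (ts : seq S) : Prop :=
  if ts is t :: ts' then form v (alpha t) < 0 /\ up (sigma t v) ts' else True.

Definition along (v : V) (ts : seq S) : V := foldl (fun u t => sigma t u) v ts.

Fixpoint big_steps (v : V) (ts : seq S) : nat :=
  if ts is t :: ts' then ((form v (alpha t) <= -1)%R + big_steps (sigma t v) ts')%N else 0%N.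

Lemma up_cat v ts1 ts2 : up v (ts1 ++ ts2) <-> up v ts1 /\ up (along v ts1) ts2.
Proof.
elim: ts1 v => [|t ts1 IH] v /=; first by tauto.
by rewrite IH; tauto.
Qed.

Lemma big_steps_cat v ts1 ts2 :
  big_steps v (ts1 ++ ts2) = (big_steps v ts1 + big_steps (along v ts1) ts2)%N.
Proof. by elim: ts1 v => //= t ts1 IH v; rewrite IH addnA. Qed.

Lemma pos_up1 v t : pos v -> form v (alpha t) < 0 -> pos (sigma t v).
Proof.
move=> pv vt; apply: pos_sigma => // E; move: vt; rewrite E form_alpha coxss; lra.
Qed.

Lemma pos_up v ts : pos v -> up v ts -> pos (along v ts).
Proof. by elim: ts v => //= t ts IH v pv [vt /IH]; apply; exact: pos_up1. Qed.

(** The hypothesis on [N] is what [run_bound] supplies; without a big step all of [ts] would be one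
    run. *)
Lemma big_steps_run N v ts : (forall (c : nat -> V) (s : nat -> S) n,
  (forall j, (j < n)%N -> c j.+1 = sigma (s j) (c j)) ->
  (forall j, (j <= n)%N -> pos (c j)) ->
  (forall j, (j < n)%N -> -1 < form (c j) (alpha (s j)) < 0) -> (n < N)%N) ->
  pos v -> up v ts -> (N <= size ts)%N -> (0 < big_steps v ts)%N.
Proof.
move=> H pv uv Nts; rewrite lt0n; apply/eqP => b0.
have [t0 _] : exists t0 : S, True by case: (pv) => -[w [t _]] _; exists t.
suff : (size ts < N)%N by lia.
have split j : (j < size ts)%N -> ts = take j ts ++ nth t0 ts j :: drop j.+1 ts.
  by move=> js; rewrite -drop_nth// cat_take_drop.
have upj j : (j <= size ts)%N -> up v (take j ts).
  by move=> js; move: uv; rewrite -{1}(cat_take_drop j ts) => /up_cat[].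
apply: (H (fun j => along v (take j ts)) (fun j => nth t0 ts j)) => j js.
- by rewrite (take_nth t0)// /along -cats1 foldl_cat.
- exact: pos_up (upj _ js).
- move: uv b0; rewrite (split j js) => /up_cat[_ [h _]] /eqP.
  rewrite big_steps_cat addn_eq0 => /andP[_] /=; rewrite addn_eq0 eqb0 -ltNge => /andP[h' _].
  by rewrite -(split j js) h h'.
Qed.

Lemma big_steps_ge N k v ts : (forall (c : nat -> V) (s : nat -> S) n,
  (forall j, (j < n)%N -> c j.+1 = sigma (s j) (c j)) ->
  (forall j, (j <= n)%N -> pos (c j)) ->
  (forall j, (j < n)%N -> -1 < form (c j) (alpha (s j)) < 0) -> (n < N)%N) ->
  pos v -> up v ts -> (k * N <= size ts)%N -> (k <= big_steps v ts)%N.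
Proof.
move=> H; elim: k v ts => // k IH v ts pv uv kN.
have Nts : (N <= size ts)%N by apply: leq_trans kN; rewrite mulSn leq_addr.
rewrite -(cat_take_drop N ts) in uv *; have [u1 u2] := (up_cat _ _ _).1 uv.
have st : size (take N ts) = N by rewrite size_takel.
rewrite big_steps_cat -add1n leq_add//; first by apply: (big_steps_run H); rewrite ?st.
by apply: IH => //; [exact: pos_up|rewrite size_drop; move: kN; rewrite mulSn; lia].
Qed.

(* The wall of [x] separates the identity from the wall of [v], or equals it. *)
Definition below (x v : V) := pos x /\ forall w : W, neg (act w v) -> neg (act w x).

(** Positivity could fail only for [x = alpha t]. The reflection in [v] inverts [v], hence [x], but
    it adds to [alpha t] a nonnegative multiple of [v]. *)
Lemma below_sigma x v t : pos v -> form v (alpha t) < 0 -> below x v ->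
  below (sigma t x) (sigma t v).
Proof.
move=> pv vt [px xv]; split=> [|w]; last first.
  by rewrite -act_gen -actM => /xv; rewrite actM act_gen.
apply: pos_sigma => // xt; have [r rE] := root_reflection (proj1 pv).
have : neg (act r x).
  apply: xv; rewrite rE (root_form (proj1 pv)) (_ : _ - _ = - v); first exact: negN.
  by apply/ffunP => s; rewrite !VE; ring.
case=> _ /(_ t); rewrite xt rE !VE alphaE eqxx formC mulr1n.
have := mulr_le0_ge0 (ltW vt) (proj2 pv t); lra.
Qed.

(** Were [act w (alpha t)] positive, [w * gen t] would make both [v] and [alpha t] negative, against
    [quadrant]. *)
Lemma below_alpha v t : pos v -> form v (alpha t) <= -1 -> below (alpha t) (sigma t v).
Proof.
move=> pv vt; split=> [|w nw]; first exact: pos_alpha.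
apply: neg_contra => [|pw]; first exact: root_act (root_alpha t).
apply: (@quadrant (w * gen t)%g v (alpha t)) => //; first exact: pos_alpha.
  by rewrite actM act_gen.
by rewrite actM act_gen sigma_alpha actN; exact: negN.
Qed.

Lemma below_along v ts (D : seq V) : pos v -> up v ts -> uniq D ->
  (forall x, x \in D -> below x v) ->
  exists D' : seq V, [/\ uniq D', size D' = (size D + big_steps v ts)%N &
    forall x, x \in D' -> below x (along v ts)].
Proof.
elim: ts v D => [|t ts IH] v D /= pv uv uD hD; first by exists D; rewrite addn0.
have [vt uv'] := uv; have pv' := pos_up1 pv vt.
have uD1 : uniq (map (sigma t) D) by rewrite (map_inj_uniq (can_inj (sigmaK t))).
have hD1 x : x \in map (sigma t) D -> below x (sigma t v).
  by move=> /mapP[y /hD hy ->]; exact: below_sigma.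
have [vt1|vt1] := boolP (form v (alpha t) <= -1).
  have [||D' [uD' sD' hD']] := IH _ (alpha t :: map (sigma t) D) pv' uv'.
  - rewrite /= uD1 andbT; apply/mapP => -[y /hD[py _] /(congr1 (sigma t))].
    rewrite sigmaK sigma_alpha => yE; apply: (pos_neg py); rewrite -yE.
    exact: negN (pos_alpha t).
  - by move=> x; rewrite in_cons => /orP[/eqP->|/hD1//]; exact: below_alpha.
  by exists D'; split=> //; rewrite sD' /= size_map; lia.
have [D' [uD' sD' hD']] := IH _ _ pv' uv' uD1 hD1.
by exists D'; split=> //; rewrite sD' size_map; lia.
Qed.

Lemma pos_descent v : pos v -> exists t, 0 < form v (alpha t).
Proof.
move=> [rv v0]; apply: contrapT => h; have := root_form rv; rewrite form_expandr => E.
have : (1 : R) <= 0; last by rewrite ler10.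
rewrite -E sumr_le0// => t _; rewrite mulr_ge0_le0//.
by rewrite leNgt; apply/negP => vt; apply: h; exists t.
Qed.

(** Induction on the length of an element inverting [v]. For [t] with positive form value, a shorter
    element inverts [v] or [sigma t v]: remove [t] on the right if it is a descent of [w], otherwise
    remove a left descent. *)
Lemma pos_chain (w : W) v : pos v -> neg (act w v) ->
  exists s ts, up (alpha s) ts /\ v = along (alpha s) ts.
Proof.
elim: {w}(len w).+1 {-2}w (ltnSn (len w)) v => // n IH w; rewrite ltnS => wn v pv nw.
case: (pselect (exists s, v = alpha s)) => [[s ->]|vs]; first by exists s, [::].
have [t vt] := pos_descent pv.
have pv' : pos (sigma t v) by apply: pos_sigma => // E; apply: vs; exists t.
suff [w' w'n nw'] : exists2 w', (len w' < n)%N & neg (act w' v) \/ neg (act w' (sigma t v)).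
  case: nw' => [/(IH _ w'n _ pv)//|/(IH _ w'n _ pv')[s [ts [u E]]]].
  exists s, (rcons ts t); rewrite -cats1 up_cat /along foldl_cat /= -/(along _ _) -E sigmaK.
  by rewrite form_sigma_alpha; do !split=> //; lra.
have rt : isroot (act w (alpha t)) by exact: root_act (root_alpha t).
case: (posVneg rt) => [pt|/neg_descent wt]; last first.
  exists (w * gen t)%g; first by lia.
  by right; rewrite actM act_gen sigmaK.
have w1 : w != 1%g by apply/eqP => w1; apply: pos_neg pv _; rewrite -(act1 v) -w1.
have [s sE] := len_descentl w1.
exists (gen s * w)%g; first by lia.
have rw u : isroot u -> isroot (act (gen s * w)%g u) by exact: root_act.
have wE u : act w u = sigma s (act (gen s * w)%g u) by rewrite actM act_gen sigmaK.
case: (posVneg (rw v (proj1 pv))) => [pw|]; last by left.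
have vE : act (gen s * w)%g v = alpha s.
  apply: contrapT => h; apply: (pos_neg _ nw); rewrite wE; exact: pos_sigma.
(* The image of [sigma t v] is [alpha s] minus a positive multiple of the image of [alpha t]; if the
   latter is positive, the difference is negative at a coordinate other than [s]. *)
right; case: (posVneg (rw _ (root_alpha t))) => [pt'|nt'].
  have ats : act (gen s * w)%g (alpha t) <> alpha s.
    by rewrite -vE => /act_inj E; apply: vs; exists t.
  have [r rs r0] := pos_coord pt' ats.
  apply: (@neg_of_coord _ r); first by apply: rw; case: pv'.
  rewrite /sigma actD actN actZ vE !VE alphaE (negPf rs) add0r oppr_lt0.
  by rewrite mulr_gt0// mulr_gt0.
case: (pos_neg pv); rewrite -(actK (gen s * w)%g v) vE.
have ps : pos (sigma s (act (gen s * w)%g (alpha t))) by rewrite -wE.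
rewrite -[alpha s]opprK -(cross_neg nt' ps).
by rewrite actN actK; exact: negN (pos_alpha t).
Qed.

(** The wall of such a root has an edge with an end within [n] of 1. *)
Definition shallow n (v : V) := exists (w : W) s, (len w <= n)%N /\ v = act w (alpha s).

Lemma along_act v ts : along v ts = act (wval (rev ts)) v.
Proof.
elim: ts v => [|t ts IH] v /=; first by rewrite act1.
by rewrite IH rev_cons -cats1 wval_cat actM /= mulg1 act_gen.
Qed.

Lemma pos_inverted v : pos v -> exists w : W, neg (act w v).
Proof.
move=> pv; have [r rE] := root_reflection (proj1 pv); exists r.
rewrite rE (root_form (proj1 pv)) (_ : _ - _ = - v); first exact: negN.
by apply/ffunP => s; rewrite !VE; ring.
Qed.

(** A chain of [k * N] steps contains [k] big ones, each adding a separating wall; a shorter chain,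
    read backwards, shows that [v] is shallow. *)
Lemma parallel_walls k : exists n, forall v, pos v -> shallow n v \/
  exists D : seq V, [/\ uniq D, (k <= size D)%N & forall x, x \in D -> below x v].
Proof.
have [N NP] := run_bound; exists (k * N)%N => v pv.
have [w nw] := pos_inverted pv; have [s [ts [u vE]]] := pos_chain pv nw.
case: (leqP (k * N) (size ts)) => h.
  right; have [//|//|D [uD sD hD]] := @below_along (alpha s) ts [::] (pos_alpha s) u.
  exists D; rewrite vE; split=> //; rewrite sD.
  exact: (big_steps_ge NP (pos_alpha s) u h).
left; exists (wval (rev ts)), s; split; last by rewrite vE along_act.
by apply: leq_trans (len_wval _) _; rewrite size_rev ltnW.
Qed.

(** * Crossing a nearby wall towards a given vertex *)

Lemma shallow_finite n : exists L : seq V, forall v, shallow n v -> v \in L.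
Proof.
elim: n => [|n [L LP]].
  exists [seq alpha s | s : S] => v [w [s [wn ->]]].
  by rewrite (@len_eq0 w) ?act1 ?map_f ?mem_enum//; lia.
exists (L ++ [seq sigma t v | t <- enum S, v <- L]) => v [w [s [wn vE]]].
rewrite mem_cat; have [w1|/len_descentl[t wE]] := eqVneq w 1%g.
  by rewrite LP//; exists 1%g, s; rewrite len1 vE w1.
apply/orP; right; rewrite -[v](sigmaK t); apply: allpairs_f; first by rewrite mem_enum.
by apply: LP; exists (gen t * w)%g, s; rewrite vE -act_gen -actM; split=> //; lia.
Qed.

Lemma bounded_seq (T : eqType) (L : seq T) (Q : T -> W -> Prop) :
  (forall x, x \in L -> exists N, forall k, Q x k -> (len k <= N)%N) ->
  exists N, forall x k, x \in L -> Q x k -> (len k <= N)%N.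
Proof.
elim: L => [|a L IH] h; first by exists 0%N.
have [|N1 h1] := IH; first by move=> x xL; apply: h; rewrite in_cons xL orbT.
have [|N2 h2] := h a; first by rewrite mem_head.
exists (maxn N1 N2) => x k; rewrite in_cons => /orP[/eqP->|xL] Qk.
  by rewrite leq_max h2 ?orbT.
by rewrite leq_max (h1 x).
Qed.

(* Relative to one solution k0, any other solution k has k k0^-1 fixing
   alpha_t for t in J and inverting some other simple root into one of the
   finitely many inversions of k0^-1: this prescribes one more root. *)
Lemma prescribed_bounded n (J : {set S}) (phi : S -> V) : (#|~: J| <= n)%N ->
  exists N, forall k : W, (forall t, t \in J -> act k^-1%g (alpha t) = phi t) ->
    (forall t, t \notin J -> pos (act k^-1%g (alpha t))) -> (len k <= N)%N.
Proof.
elim: n J phi => [|n IH] J phi Jn.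
all: case: (pselect (exists k : W, (forall t, t \in J -> act k^-1%g (alpha t) = phi t) /\
    (forall t, t \notin J -> pos (act k^-1%g (alpha t))))) => [[k0 [k0J k0p]]|h];
  last by exists 0%N => k kJ kp; case: h; exists k.
all: have fixed (k : W) t : (forall t, t \in J -> act k^-1%g (alpha t) = phi t) ->
    t \in J -> act (k0 * k^-1)%g (alpha t) = alpha t by
  move=> kJ tJ; rewrite actM kJ// -k0J// actVK.
  exists (len k0) => k kJ kp; suff -> : k = k0 by [].
  apply/eqP; rewrite eq_sym -divg_eq1; apply/eqP/act_id => t; apply: fixed => //.
  apply: contraLR Jn => tJ; rewrite -ltnNge; apply/card_gt0P.
  by exists t; rewrite finset.in_setC.
have [L LP] := finite_inversions k0^-1%g.
pose Q (x : S * V) (k : W) := [/\ x.1 \notin J,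
  forall t, t \in x.1 |: J ->
    act k^-1%g (alpha t) = if t == x.1 then - act k0^-1%g x.2 else phi t &
  forall t, t \notin x.1 |: J -> pos (act k^-1%g (alpha t))].
have [|N NP] := @bounded_seq _ [seq (t, z) | t <- enum S, z <- L] Q.
  move=> [t z] _; have [tJ|tJ] := boolP (t \in J).
    by exists 0%N => k [/=]; rewrite tJ.
  have [|N NP] := IH (t |: J) (fun r => if r == t then - act k0^-1%g z else phi r).
    have := cardsC J; have := cardsC (t |: J); rewrite cardsU1 tJ /=.
    by move: Jn; set a := #|~: J|; set b := #|~: (t |: J)|; lia.
  by exists N => k [/= _ k1 k2]; exact: NP.
exists (maxn (len k0) N) => k kJ kp; rewrite leq_max.
have [->|kk0] := eqVneq k k0; first by rewrite leqnn.
have [|t nt] := @neg_descent_ex (k0 * k^-1)%g; first by rewrite divg_eq1 eq_sym.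
have tJ : t \notin J.
  by apply/negP => tJ; move: nt; rewrite fixed//; exact: pos_neg (pos_alpha t).
set z := - act (k0 * k^-1)%g (alpha t).
have zE : act k0^-1%g z = - act k^-1%g (alpha t) by rewrite /z actN actM actK.
have zL : z \in L.
  by apply: LP; [exact: posN|rewrite zE; apply: negN; exact: kp].
apply/orP; right; apply: (NP (t, z)); first by rewrite allpairs_f// mem_enum.
split=> //= r; rewrite in_setU1.
  by case: eqP => [->|_ /=]; rewrite ?zE ?opprK// => /kJ.
by rewrite negb_or => /andP[_]; exact: kp.
Qed.

(** There are finitely many shallow roots; for each one [prescribed_bounded] applies with [J] the
    singleton of [s]. *)
Lemma unique_descent_bounded n : exists N, forall (k : W) s,
  shallow n (- act k^-1%g (alpha s)) ->
  (forall t, t != s -> pos (act k^-1%g (alpha t))) -> (len k <= N)%N.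
Proof.
have [L LP] := shallow_finite n.
pose Q (x : S * V) (k : W) := (- act k^-1%g (alpha x.1) = x.2) /\
  (forall t, t != x.1 -> pos (act k^-1%g (alpha t))).
have [|N NP] := @bounded_seq _ [seq (s, e) | s <- enum S, e <- L] Q.
  move=> [s e] _; have [N NP] := @prescribed_bounded #|~: [set s]| [set s] (fun=> - e) (leqnn _).
  exists N => k [/= kE kp]; apply: NP => t; rewrite inE.
    by move/eqP->; rewrite -kE opprK.
  exact: kp.
exists N => k s /LP kL kp; apply: (NP (s, - act k^-1%g (alpha s))) => //.
by rewrite allpairs_f// mem_enum.
Qed.

(** Let [u], between [x] and [v] and on the side of [x], be nearest to [v]. Every first step of a
    geodesic from [u] to [v] must then cross the wall, so [u^-1 * v] has a single left descent. *)
Lemma nearby_crossing n : exists N, forall (x v : W) g,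
  neg (act x^-1%g g) -> pos (act v^-1%g g) -> shallow n (act v^-1%g g) ->
  exists u, [/\ betw x u v, neg (act u^-1%g g) & (len (u^-1 * v)%g <= N)%N].
Proof.
have [N NP] := unique_descent_bounded n; exists N => x v g nx pv sv.
pose P l := `[< exists u : W, [/\ betw x u v, neg (act u^-1%g g) & len (u^-1 * v)%g = l] >].
have P0 : P (len (x^-1 * v)%g) by apply/asboolP; exists x; split.
case: (ex_minnP (ex_intro P _ P0)) => l /asboolP[u [bu nu ul]] lmin.
exists u; split=> //; set k := (u^-1 * v)%g in ul *.
have kE y : act k^-1%g y = act v^-1%g (act u y) by rewrite /k invgM invgK actM.
have desc t : neg (act k^-1%g (alpha t)) -> act u^-1%g g = - alpha t.
  move=> nt; apply: contrapT => h.
  have /lmin : P (len (gen t * k)%g); last first.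
    rewrite -ul leqNgt -(lenV k) -(lenV (gen t * k)%g) invgM genV.
    by rewrite (neg_descent nt).
  apply/asboolP; exists (u * gen t)%g; split.
  - move=> y yx yv; have yu := bu _ yx yv; rewrite invgM genV actM act_gen.
    apply: neg_contra => [|py]; first by apply: root_sigma; case: yu.
    have yE := cross_neg yu py; apply: (pos_neg _ yv).
    by rewrite -(actVK u y) -kE yE actN; exact: posN.
  - rewrite invgM genV actM act_gen; apply: neg_contra => [|pg].
      by apply: root_sigma; case: nu.
    by apply: h; exact: cross_neg.
  - by rewrite /k invgM genV mulgA.
have k1 : k^-1%g != 1%g.
  apply/eqP => k1; apply: (pos_neg pv); rewrite -(actVK u g) -kE k1 act1.
  exact: nu.
have [s ns] := neg_descent_ex k1; have gE := desc _ ns.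
apply: (NP k s).
  by rewrite -actN -gE kE actVK.
move=> t ts; apply: pos_contra => [|nt]; first exact: root_act (root_alpha t).
by move: ts; rewrite (alpha_inj (oppr_inj (etrans (esym (desc _ nt)) gE))) eqxx.
Qed.

(** * Walls of the Cayley graph *)

Definition reflection_of (r : W) (v : V) := exists (w : W) s,
  v = act w (alpha s) /\ r = (w * gen s * w^-1)%g.

Lemma reflection_of_ex v : isroot v -> exists r, reflection_of r v.
Proof. by move=> [w [s ->]]; exists (w * gen s * w^-1)%g, w, s. Qed.

Lemma reflection_of_eq r r' v v' : reflection_of r v -> reflection_of r' v' ->
  v = v' \/ v = - v' -> r = r'.
Proof.
by move=> [w [s [-> ->]]] [w' [s' [-> ->]]]; exact: reflection_eq.
Qed.

Lemma reflection_of_inj r v v' : reflection_of r v -> reflection_of r v' ->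
  v = v' \/ v = - v'.
Proof. by move=> [w [s [-> ->]]] [w' [s' [-> /reflection_root]]]. Qed.

Lemma reflection_of_reflection r v : reflection_of r v -> reflection gen r.
Proof. by move=> [w [s [_ ->]]]; exists w, s. Qed.

Lemma gen_neq1 s : gen s != 1%g.
Proof.
apply/eqP => s1; have := act_gen s (alpha s); rewrite s1 act1 sigma_alpha => E.
by apply: (pos_neg (pos_alpha s)); rewrite {1}E; exact: negN (pos_alpha s).
Qed.

Lemma edge_eq (x y w : W) s : edge x y = edge w (w * gen s)%g ->
  (x = w /\ y = (w * gen s)%g) \/ (x = (w * gen s)%g /\ y = w).
Proof.
move=> E; have wws : w <> (w * gen s)%g.
  by move/esym/eqP; rewrite -{2}(mulg1 w) (inj_eq (mulgI w)) (negPf (gen_neq1 s)).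
have hx : edge w (w * gen s)%g x by rewrite -E; left.
have hy : edge w (w * gen s)%g y by rewrite -E; right.
have hw : edge x y w by rewrite E; left.
have hv : edge x y (w * gen s)%g by rewrite E; right.
case: hx hy hw hv => /= -> [] /= ->; first by move=> _ [] /= /esym.
- by left.
- by right.
by move=> [] /= /wws.
Qed.

Lemma wall_edge (r x y : W) : wall_of gen r (edge x y) ->
  exists g s, [/\ reflection_of r g, act x^-1%g g = alpha s & act y^-1%g g = - alpha s].
Proof.
move=> [w [s [E rw rws]]].
have rE : r = (w * gen s * w^-1)%g by rewrite -rw mulgK.
case: (edge_eq E) => -[-> ->].
  exists (act w (alpha s)), s; split; first by exists w, s.
    by rewrite actK.
  by rewrite invgM genV actM actK act_gen sigma_alpha.
exists (act (w * gen s)%g (alpha s)), s; split; last first.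
- by rewrite actM actK act_gen sigma_alpha.
- by rewrite actK.
exists (w * gen s)%g, s; split => //.
by rewrite rE invgM genV mulgenK mulgA.
Qed.

(** [sigma s] changes the sign of no root except [alpha s] and its negative. *)
Lemma crossed_edge (r x : W) s g : reflection_of r g ->
  (pos (act x^-1%g g) /\ neg (act (x * gen s)^-1%g g)) \/
  (neg (act x^-1%g g) /\ pos (act (x * gen s)^-1%g g)) ->
  wall_of gen r (edge x (x * gen s)%g).
Proof.
rewrite invgM genV actM act_gen => rg h.
have xE : act x (alpha s) = g \/ act x (alpha s) = - g.
  case: h => -[h1 h2].
    left; rewrite -[g](actVK x); congr (act x _); symmetry; apply: contrapT => h.
    by apply: (pos_neg _ h2); exact: pos_sigma.
  by right; rewrite -[g](actVK x) (cross_neg h1 h2) actN opprK.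
have rE : (x * gen s * x^-1)%g = r.
  by apply: reflection_of_eq rg xE; exists x, s.
exists x, s; split=> //; rewrite -rE; first by rewrite mulgVK.
by rewrite mulgA mulgVK mulgenK.
Qed.

Lemma wall_of_inj (r r' : W) : reflection gen r -> wall_of gen r = wall_of gen r' -> r = r'.
Proof.
move=> [w [s rE]] E.
have : wall_of gen r (edge w (w * gen s)%g).
  exists w, s; split=> //; rewrite rE; first by rewrite mulgVK.
  by rewrite mulgA mulgVK mulgenK.
rewrite E => -[w' [s' [/esym/edge_eq E' h1 h2]]].
have h : (r' * w)%g = (w * gen s)%g.
  by case: E' => -[wE1 wE2]; rewrite wE2 wE1 in h1 h2.
by rewrite rE -h mulgK.
Qed.

Lemma shallow_act n k v (w : W) : shallow n v -> (len w <= k)%N -> shallow (k + n) (act w v).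
Proof.
move=> [u [s [un ->]]] wk; exists (w * u)%g, s; rewrite actM; split=> //.
by apply: leq_trans (lenM _ _) _; rewrite leq_add.
Qed.

Lemma shallowW n k v : (n <= k)%N -> shallow n v -> shallow k v.
Proof. by move=> nk [u [s [un ->]]]; exists u, s; rewrite (leq_trans un). Qed.

Lemma card_ordinal_image T (U : finType) (f : U -> T) :
  ([set f x | x in [set: U]] #<= `I_#|U|)%classic%card.
Proof.
have -> : [set f x | x in [set: U]]%classic = [set (f \o enum_val) i | i in [set: 'I_#|U|]]%classic.
  apply/seteqP; split=> [y [x _ <-]|y [i _ <-]]; last by exists (enum_val i).
  by exists (enum_rank x) => //=; rewrite enum_rankK.
by apply: card_le_trans (card_image_le _ _) _; have /card_eqPle[] := @card_II #|U|.
Qed.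

Lemma shallow_walls_bounded n (t : W) (A : set (set (set W))) :
  (forall Q, A Q -> exists r g, [/\ Q = wall_of gen r, reflection_of r g &
     shallow n (act t^-1%g g) \/ shallow n (act t^-1%g (- g))]) ->
  (A #<= `I_#|{: n.-bseq S * S}|)%card.
Proof.
move=> hA; pose f (x : n.-bseq S * S) :=
  wall_of gen ((t * wval x.1) * gen x.2 * (t * wval x.1)^-1)%g.
apply: card_le_trans (card_ordinal_image f); apply: subset_card_le => Q /hA[r [g [-> rg h]]].
have [w [s [wn gE]]] : exists (w : W) s, (len w <= n)%N /\
    (act (t * w)%g (alpha s) = g \/ act (t * w)%g (alpha s) = - g).
  case: h => -[w [s [wn E]]]; exists w, s; split=> //; [left|right].
    by rewrite actM -E actVK.
  by rewrite actM -E actVK.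
have [u uE su] := lenP w; have un : (size u <= n)%N by rewrite su.
exists (Bseq un, s) => //; rewrite /f /= uE; congr (wall_of gen _).
by apply: reflection_of_eq rg gE; exists (t * w)%g, s.
Qed.

(** * Bracketing walls of a tracked path *)

Lemma len_sym (x y : W) : len (x^-1 * y)%g = len (y^-1 * x)%g.
Proof. by rewrite -lenV invgM invgK. Qed.

Lemma len_triangle (y x z : W) :
  (len (x^-1 * z)%g <= len (x^-1 * y)%g + len (y^-1 * z)%g)%N.
Proof. by rewrite (leq_trans _ (lenM _ _))// mulgA mulgK. Qed.

Lemma separated_le (x y : W) (D : seq V) : uniq D ->
  (forall v, v \in D -> pos (act x^-1%g v) /\ neg (act y^-1%g v)) ->
  (size D <= len (x^-1 * y)%g)%N.
Proof.
move=> uD h; rewrite -(size_map (act x^-1%g)); apply: inversions_le.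
  by rewrite (map_inj_uniq (@act_inj _)).
by move=> v /mapP[w /h[pw nw] ->]; rewrite invgM invgK actM actVK.
Qed.

(** Otherwise 2 K + 1 walls separate [z] from both [x'] and [y']. As [z] is between [x] and [y],
    each separates [x] from [x'] or [y] from [y'], and at most K do either. *)
Lemma geodesic_near_wall K : exists n, forall (x y z x' y' : W) g,
  betw x z y -> (len (x^-1 * x')%g <= K)%N -> (len (y^-1 * y')%g <= K)%N ->
  pos (act z^-1%g g) -> neg (act x'^-1%g g) -> neg (act y'^-1%g g) ->
  shallow n (act z^-1%g g).
Proof.
have [n nP] := parallel_walls (K + K).+1; exists n => x y z x' y' g bxy xK yK pz nx ny.
case: (nP _ pz) => // -[D [uD sD hD]].
pose D' := map (act z) D.
have uD' : uniq D' by rewrite (map_inj_uniq (@act_inj _)).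
have hD' v : v \in D' -> [/\ pos (act z^-1%g v), neg (act x'^-1%g v) & neg (act y'^-1%g v)].
  move=> /mapP[w /hD[pw wz] ->]; rewrite actK; split=> //.
    by rewrite -actM; apply: wz; rewrite actM actVK.
  by rewrite -actM; apply: wz; rewrite actM actVK.
pose px v := `[< pos (act x^-1%g v) >].
have c1 : (size [seq v <- D' | px v] <= K)%N.
  apply: leq_trans xK; apply: separated_le; first exact: filter_uniq.
  by move=> v; rewrite mem_filter => /andP[/asboolP pv /hD'[]].
have c2 : (size [seq v <- D' | ~~ px v] <= K)%N.
  apply: leq_trans yK; apply: separated_le; first exact: filter_uniq.
  move=> v; rewrite mem_filter => /andP[/asboolP pv /hD'[pzv nxv nyv]]; split=> //.
  have rv : isroot v by apply: (@root_of_act z^-1%g); case: pzv.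
  apply: pos_contra => [|nyy]; first exact: root_act.
  apply: (pos_neg pzv); apply: bxy => //.
  by apply: neg_contra => //; exact: root_act.
have := count_predC px D'; rewrite -!size_filter size_map => E.
by move: sD; rewrite -E; have := leq_add c1 c2; rewrite ltnNge => ->.
Qed.

Lemma int_ivt (l : nat -> int) (M : nat) (c : int) a b :
  (forall k, `|l k.+1 - l k| <= M%:Z) -> (a <= b)%N -> l a <= c <= l b ->
  exists p, (a <= p <= b)%N /\ `|l p - c| <= M%:Z.
Proof.
move=> step ab; rewrite -(subnKC ab); elim: (b - a)%N => [|d IH] h.
  by exists a; rewrite addn0 leqnn; split=> //; move: h; rewrite addn0; lia.
case: (leP c (l (a + d)%N)) => hc.
  have [|p [ap hp]] := IH; first by case/andP: h => ->.
  by exists p; split=> //; lia.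
exists (a + d.+1)%N; split; first by lia.
by move: h; have := step (a + d)%N; rewrite -addnS; lia.
Qed.

(** If [l k] lies beyond both [l i] and [l j], the one closer to [l k] is nearly attained again on
    the other side of [k], and [hC] puts [k] near [i] or [j]. *)
Lemma coarse_order (l : nat -> int) (M C : nat) i k j :
  (forall k, `|l k.+1 - l k| <= M%:Z) ->
  (forall p q, `|l p - l q| <= M%:Z -> (p - q <= C)%N) -> (i <= k <= j)%N ->
  [\/ (k - i <= C)%N, (j - k <= C)%N, l i <= l k <= l j | l j <= l k <= l i].
Proof.
move=> step hC /andP[ik kj].
have main (f : nat -> int) : (forall k, `|f k.+1 - f k| <= M%:Z) ->
    (forall p q, `|f p - f q| <= M%:Z -> (p - q <= C)%N) ->
    f i <= f k -> f j <= f k -> (k - i <= C)%N \/ (j - k <= C)%N.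
  move=> fstep fC hik hjk; case: (leP (f i) (f j)) => hij.
    have [|p [/andP[ip pk] hp]] := @int_ivt f M (f j) i k fstep ik; first by rewrite hij.
    by right; have := fC j p; rewrite distrC => /(_ hp); lia.
  have Nstep q : `|(- f q.+1) - (- f q)| <= M%:Z by have := fstep q; lia.
  have [|p [/andP[kp pj] hp]] := @int_ivt (fun q => - f q) M (- f i) k j Nstep kj; first lia.
  by left; have := fC p i; lia.
case: (leP (l i) (l k)) => hik; case: (leP (l j) (l k)) => hjk.
- by case: (main l step hC hik hjk) => h; [constructor 1|constructor 2].
- by constructor 3; lia.
- by constructor 4; lia.
have Nstep q : `|(- l q.+1) - (- l q)| <= M%:Z by have := step q; lia.
have NC p q : `|(- l p) - (- l q)| <= M%:Z -> (p - q <= C)%N by move=> h; apply: hC; lia.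
have [||h|h] := main (fun q => - l q) Nstep NC; rewrite ?lerN2 ?ltW//.
  by constructor 1.
by constructor 2.
Qed.

Section Path.

Variable b : nat -> W.
Hypothesis b_step : forall k, exists s, b k.+1 = (b k * gen s)%g.

Lemma path_len i j : (i <= j)%N -> (len ((b i)^-1 * b j)%g <= j - i)%N.
Proof.
move=> ij; rewrite -{1}(subnKC ij); elim: (j - i)%N => [|d IH].
  by rewrite addn0 mulVg len1.
have [s sE] := b_step (i + d); rewrite addnS sE mulgA.
by rewrite (leq_trans (lenMgen _ _)).
Qed.

Definition crosses i g := exists s,
  (act (b i)^-1%g g = alpha s /\ act (b i.+1)^-1%g g = - alpha s) \/
  (act (b i)^-1%g g = - alpha s /\ act (b i.+1)^-1%g g = alpha s).

Lemma crossesN i g : crosses i g -> crosses i (- g).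
Proof.
by move=> [s [[h1 h2]|[h1 h2]]]; exists s; rewrite !actN h1 h2 !opprK; [right|left].
Qed.

Lemma crosses_neg_end i g : crosses i g ->
  exists2 y, neg (act y^-1%g g) & (len ((b i)^-1 * y)%g <= 1)%N.
Proof.
have nN s := negN (pos_alpha s).
move=> [s [[h1 h2]|[h1 h2]]]; [exists (b i.+1)|exists (b i)]; rewrite ?h1 ?h2 ?mulVg ?len1//.
by have := path_len (leqnSn i); rewrite subSnn.
Qed.

Lemma crosses_shallow i k n g : crosses i g -> (len ((b k)^-1 * b i)%g <= n)%N ->
  shallow n (act (b k)^-1%g g) \/ shallow n (act (b k)^-1%g (- g)).
Proof.
have E y : act (b k)^-1%g y = act ((b k)^-1 * b i)%g (act (b i)^-1%g y).
  by rewrite actM actVK.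
move=> [s [[h1 _]|[h1 _]]] kn; [left|right]; rewrite E; exists ((b k)^-1 * b i)%g, s.
  by rewrite h1.
by rewrite actN h1 opprK.
Qed.

Lemma tracked_crossings (a : int -> W) (l : nat -> int) (K : nat) (Phi : nat -> nat) :
  (forall c p q, (len ((b p)^-1 * b q)%g <= c)%N -> (p - q <= Phi c)%N) ->
  (forall p q, (len ((a (l p))^-1 * a (l q))%g)%:Z = `|l p - l q|) ->
  (forall p, (len ((b p)^-1 * a (l p))%g <= K)%N) ->
  exists n, forall i k j g, isroot g -> (i < k <= j)%N -> crosses i g -> crosses j g ->
    shallow n (act (b k)^-1%g g) \/ shallow n (act (b k)^-1%g (- g)).
Proof.
move=> hPhi ha hK.
have hK' p : (len ((a (l p))^-1 * b p)%g <= K)%N by rewrite len_sym.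
(* Trackers of consecutive vertices are at most K + 1 + K apart; trackers within [M] belong to
   vertices within K + M + K. *)
pose M := (K + K).+1; pose C := Phi (K + M + K)%N.
(* The negative end of a crossed edge is within 1 of the path vertex, so within K + 1 of its
   tracker. *)
have [n nP] := geodesic_near_wall K.+1.
have step p : `|l p.+1 - l p| <= M%:Z.
  rewrite -ha /M lez_nat len_sym.
  have h1 := len_triangle (b p) (a (l p)) (a (l p.+1)).
  have h2 := len_triangle (b p.+1) (b p) (a (l p.+1)).
  have := path_len (leqnSn p); rewrite subSnn; have := hK p.+1; have := hK' p; lia.
have close p q : `|l p - l q| <= M%:Z -> (p - q <= C)%N.
  rewrite -ha lez_nat => h; apply: hPhi.
  have h1 := len_triangle (a (l p)) (b p) (b q).
  have h2 := len_triangle (a (l q)) (a (l p)) (b q).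
  have := hK p; have := hK' q; lia.
(* [C] serves when [k] is close in time to a crossing, [K + n] when the tracker of [b k] lies
   between the other two. *)
exists (maxn C (K + n)) => i k j g rg /andP[ik kj] ci cj.
have near p : crosses p g -> (len ((b k)^-1 * b p)%g <= C)%N ->
    shallow (maxn C (K + n)) (act (b k)^-1%g g) \/
    shallow (maxn C (K + n)) (act (b k)^-1%g (- g)).
  by move=> cp h; case: (crosses_shallow cp h) => h'; [left|right];
     apply: shallowW h'; rewrite leq_maxl.
have mid g' : isroot g' -> crosses i g' -> crosses j g' ->
    betw (a (l i)) (a (l k)) (a (l j)) -> pos (act (a (l k))^-1%g g') ->
    shallow (maxn C (K + n)) (act (b k)^-1%g g').
  move=> rg' /crosses_neg_end[x' nx' xi] /crosses_neg_end[y' ny' yj] bt pk.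
  apply: (@shallowW (K + n)); first by rewrite leq_maxr.
  rewrite -(actVK (a (l k)) g') -actM; apply: shallow_act (hK k).
  apply: (nP _ _ _ x' y' _ bt) => //.
    by have := len_triangle (b i) (a (l i)) x'; have := hK' i; lia.
  by have := len_triangle (b j) (a (l j)) y'; have := hK' j; lia.
have mid' : betw (a (l i)) (a (l k)) (a (l j)) ->
    shallow (maxn C (K + n)) (act (b k)^-1%g g) \/
    shallow (maxn C (K + n)) (act (b k)^-1%g (- g)).
  move=> bt; case: (posVneg (root_act (a (l k))^-1%g rg)) => h; [left|right].
    exact: mid.
  apply: mid => //; [exact: rootN|exact: crossesN|exact: crossesN|].
  by rewrite actN; exact: posN.
have order : (l i <= l k <= l j) || (l j <= l k <= l i) -> betw (a (l i)) (a (l k)) (a (l j)).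
  move=> h; apply/betw_len; apply/eqP; rewrite -eqz_nat PoszD !ha; apply/eqP; lia.
case: (@coarse_order l M C i k j step close); first by rewrite (ltnW ik).
- move=> h; apply: (near i) => //; rewrite len_sym.
  by apply: leq_trans (path_len (ltnW ik)) _.
- by move=> h; apply: (near j) => //; apply: leq_trans (path_len kj) _.
- by move=> h; apply: mid'; apply: order; rewrite h.
- by move=> h; apply: mid'; apply: order; rewrite h orbT.
Qed.

(** * Construction of the tracking geodesic *)

Lemma betw_trans (x u v y : W) : betw x v y -> betw x u v -> betw x u y.
Proof. by move=> h1 h2 g nx ny; apply: h2 => //; exact: h1. Qed.

Lemma betw_inner (x u v y : W) : betw x u y -> betw u v y -> betw x u v.
Proof.
move=> h1 h2 g nx nv; have rg : isroot g by apply: (@root_of_act x^-1%g); case: nx.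
apply: neg_contra => [|pu]; first exact: root_act.
case: (posVneg (root_act y^-1%g rg)) => [py|ny].
  by apply: pos_neg nv; exact: (betw_pos h2).
by apply: pos_neg pu _; exact: h1.
Qed.

Lemma betw_outer (x u v y : W) : betw x u y -> betw u v y -> betw x v y.
Proof. by move=> h1 h2 g nx ny; apply: h2 => //; exact: h1. Qed.

Section Approach.

Variable N : nat.
Hypothesis b_bracket : forall k (D : seq V), uniq D ->
  (forall g, g \in D -> [/\ pos (act (b k)^-1%g g), neg (act (b 0)^-1%g g) &
     exists2 j, (k <= j)%N & neg (act (b j)^-1%g g)]) -> (size D <= N)%N.

(* The walls that must be crossed to move [u] towards [p] until it lies
   between [p] and all later vertices. *)
Definition obstacle k (p u : W) g := [/\ pos (act u^-1%g g), neg (act p^-1%g g) &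
  exists2 j, (k <= j)%N & neg (act (b j)^-1%g g)].

Lemma remove_obstacles : exists rho, forall k p M u, (M <= N)%N -> betw p u (b k) ->
  (forall D : seq V, uniq D -> (forall g, g \in D -> obstacle k p u g) -> (size D <= M)%N) ->
  exists q, [/\ betw p q (b k), forall g, ~ obstacle k p q g &
    (len (q^-1 * u)%g <= M * rho)%N].
Proof.
have [n nP] := parallel_walls N.+1; have [rho rhoP] := nearby_crossing n.
exists rho => k p; elim=> [|M IH] u MN bu hD.
all: case: (pselect (exists g, obstacle k p u g)) => [[g og]|h];
  last by exists u; split=> [//|g og|]; [apply: h; exists g|rewrite mulVg len1].
  by suff : (size [:: g] <= 0)%N by []; apply: hD => // g'; rewrite inE => /eqP->.
have [pu np [j kj nj]] := og; have rg : isroot g by apply: (@root_of_act p^-1%g); case: np.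
case: (nP _ pu) => [su|[D [uD sD Dg]]]; last first.
  have := hD (map (act u) D); rewrite (map_inj_uniq (@act_inj u)) size_map => /(_ uD) h.
  suff : (size D <= M.+1)%N by lia.
  apply: h => _ /mapP[y /Dg[py yg] ->].
  have E w : act w^-1%g (act u y) = act (w^-1 * u)%g y by rewrite actM.
  have neg_at w : neg (act w^-1%g g) -> neg (act w^-1%g (act u y)).
    by move=> nw; rewrite E; apply: yg; rewrite actM actVK.
  by split; [rewrite actK|exact: neg_at|exists j => //; exact: neg_at].
have [u1 [b1 n1 l1]] := rhoP p u g np pu su.
have [|q [bq oq lq]] := IH u1 (ltnW MN) (betw_trans bu b1).
  move=> D uD hD1; rewrite -ltnS; apply: (hD (g :: D)) => /=.
    by rewrite uD andbT; apply/negP => /hD1[/pos_neg/(_ n1)].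
  move=> g'; rewrite in_cons => /orP[/eqP->//|/hD1[pu1 np' hj]]; split=> //.
  apply: pos_contra => [|nu]; last by apply: pos_neg pu1 _; exact: b1.
  by apply: root_act; apply: (@root_of_act p^-1%g); case: np'.
exists q; split=> //; apply: leq_trans (len_triangle u1 q u) _.
by rewrite mulSn addnC leq_add.
Qed.

(** Start at [u = b k]. As [p] lies between [b 0] and [b k], obstacles there also separate [b k]
    from [b 0], so [b_bracket] counts them; having none left is betweenness for all later
    vertices. *)
Lemma approach : exists C, forall k p, (forall j, (k <= j)%N -> betw (b 0) p (b j)) ->
  exists q, (forall j, (k <= j)%N -> betw p q (b j)) /\ (len (q^-1 * b k)%g <= C)%N.
Proof.
have [rho rhoP] := remove_obstacles; exists (N * rho)%N => k p hp.
have bp : betw p (b k) (b k) by move=> g.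
have [|q [bq oq lq]] := rhoP k p N (b k) (leqnn N) bp.
  move=> D uD hD; apply: (@b_bracket k _ uD) => g /hD[pk np hj]; split=> //.
  have rg : isroot g by apply: (@root_of_act p^-1%g); case: np.
  apply: neg_contra => [|p0]; first exact: root_act.
  by apply: pos_neg np; apply: (betw_pos (hp k (leqnn k))).
exists q; split=> // j kj g np nj.
have rg : isroot g by apply: (@root_of_act p^-1%g); case: np.
apply: neg_contra => [|pq]; first exact: root_act.
by apply: (oq g); split=> //; exists j.
Qed.

Lemma monotone_chain : exists C (p : nat -> W), [/\ p 0%N = b 0,
  forall k, betw (b 0) (p k) (p k.+1) & forall k, (len ((p k)^-1 * b k)%g <= C)%N].
Proof.
have [C CP] := approach.
pose hyp k p := forall j, (k <= j)%N -> betw (b 0) p (b j).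
pose res k p q := (forall j, (k <= j)%N -> betw p q (b j)) /\ (len (q^-1 * b k)%g <= C)%N.
(* [f] is specified only where [hyp] holds; [inv] shows that the recursion stays there. *)
have [f fP] : {f & forall x : nat * W, hyp x.1 x.2 -> res x.1 x.2 (f x)}.
  apply: (@boolp.choice _ _ (fun (x : nat * W) q => hyp x.1 x.2 -> res x.1 x.2 q)) => -[k p].
  case: (pselect (hyp k p)) => [/CP[q hq]|h]; first by exists q.
  by exists p.
pose p := fix p k := if k is k'.+1 then f (k, p k') else b 0.
have inv k : hyp k (p k).
  elim: k => [|k IH] j kj; first by move=> g.
  have h : hyp k.+1 (p k) by move=> i ki; apply: IH; exact: ltnW.
  have [h1 _] := fP (k.+1, p k) h.
  exact: betw_outer (h _ kj) (h1 _ kj).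
have step k : res k.+1 (p k) (p k.+1).
  by apply: (fP (k.+1, p k)) => i ki; apply: inv; exact: ltnW.
exists C, p; split=> // k.
  have [h1 _] := step k; apply: (betw_inner _ (h1 _ (leqnn _))).
  exact: inv.
case: k => [|k]; first by rewrite /= mulVg len1.
by have [_] := step k.
Qed.

End Approach.

(** Concatenated geodesic words stay reduced by betweenness, each being a prefix of the next; [a]
    follows the limiting infinite word. *)
Lemma geodesic_ray (x : W) (p : nat -> W) : p 0%N = x ->
  (forall k, betw x (p k) (p k.+1)) ->
  (forall n, exists k, (n <= len (x^-1 * p k)%g)%N) ->
  exists a : nat -> W, [/\ forall n, exists s, a n.+1 = (a n * gen s)%g,
    forall i j, (i <= j)%N -> len ((a i)^-1 * a j)%g = (j - i)%N &
    forall k, exists i, a i = p k].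
Proof.
move=> p0 bp unb.
have [w wP] : {w : nat -> seq S & forall k, wval (w k) = ((p k)^-1 * p k.+1)%g /\
    size (w k) = len ((p k)^-1 * p k.+1)%g}.
  apply: (@boolp.choice _ _ (fun k u => wval u = ((p k)^-1 * p k.+1)%g /\
    size u = len ((p k)^-1 * p k.+1)%g)) => k.
  by have [u uE us] := lenP ((p k)^-1 * p k.+1)%g; exists u.
pose u := fix u k := if k is k'.+1 then u k' ++ w k' else [::].
have uE k : wval (u k) = (x^-1 * p k)%g.
  elim: k => [|k IH] /=; first by rewrite p0 mulVg.
  by rewrite wval_cat IH (wP k).1 mulgA mulgK.
have us k : size (u k) = len (x^-1 * p k)%g.
  elim: k => [|k IH] /=; first by rewrite p0 mulVg len1.
  by rewrite size_cat IH (wP k).2; apply/betw_len.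
have u_take n i j : (n <= size (u i))%N -> (i <= j)%N -> take n (u j) = take n (u i).
  move=> ni ij; rewrite -(subnKC ij); elim: (j - i)%N => [|d IH]; first by rewrite addn0.
  have sd : (n <= size (u (i + d)))%N.
    by have := size_takel ni; rewrite -IH size_take_min => <-; exact: geq_minr.
  by rewrite addnS /= takel_cat.
(* By stage [K n] the word has at least [n] letters; [u_take] makes [a n] independent of the
   choice. *)
have [K KP] := @boolp.choice _ _ _ unb.
pose a n := (x * wval (take n (u (K n))))%g.
have aE n k : (n <= size (u k))%N -> a n = (x * wval (take n (u k)))%g.
  move=> nk; have nK : (n <= size (u (K n)))%N by rewrite us.
  rewrite /a; case: (leqP k (K n)) => h; first by rewrite (u_take n k).
  by rewrite -(u_take n (K n) k)// ltnW.
exists a; split.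
- move=> n; have nK : (n < size (u (K n.+1)))%N by rewrite us.
  case E : (u (K n.+1)) => [|s0 l]; first by rewrite E in nK.
  exists (nth s0 (u (K n.+1)) n); rewrite (aE n.+1 (K n.+1))// (aE n (K n.+1)) 1?ltnW//.
  by rewrite (take_nth s0)// -cats1 wval_cat /= mulg1 mulgA.
- move=> i j ij; have jK : (j <= size (u (K j)))%N by rewrite us.
  rewrite (aE j _ jK) (aE i _ (leq_trans ij jK)).
  set v := u (K j) in jK *.
  have vE : v = take i v ++ drop i (take j v) ++ drop j v.
    by rewrite catA -{1}(take_takel v ij) cat_take_drop cat_take_drop.
  have E : wval (take j v) = (wval (take i v) * wval (drop i (take j v)))%g.
    by rewrite -wval_cat -(take_takel v ij) cat_take_drop.
  rewrite E invgM -!mulgA mulKg mulKg.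
  (* Factors of a reduced word are reduced: a shorter middle factor would shorten all of [v]. *)
  have sv : size v = len (wval v) by rewrite /v uE us.
  have h1 := len_wval (drop i (take j v)); rewrite size_drop size_takel// in h1.
  have h2 := len_wval (take i v); rewrite size_takel ?(leq_trans ij)// in h2.
  have h3 := len_wval (drop j v); rewrite size_drop in h3.
  have := lenM (wval (take i v)) (wval (drop i (take j v)) * wval (drop j v))%g.
  rewrite -wval_cat -wval_cat -vE -sv wval_cat.
  have := lenM (wval (drop i (take j v))) (wval (drop j v)); lia.
move=> k; exists (size (u k)); rewrite (aE _ k)// take_size uE.
by rewrite mulVKg.
Qed.

End Path.

Lemma sign_change (P : nat -> Prop) i j : (i <= j)%N -> P i -> ~ P j ->
  exists k, [/\ (i <= k < j)%N, P k & ~ P k.+1].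
Proof.
move=> ij; rewrite -(subnKC ij); elim: (j - i)%N => [|d IH] Pi; first by rewrite addn0.
rewrite addnS => nP; case: (pselect (P (i + d)%N)) => h; first by exists (i + d)%N; split=> //; lia.
by have [k [ik Pk nPk]] := IH Pi h; exists k; split=> //; lia.
Qed.

(** * The two implications for the ray [beta] *)

Section Main.

Variable beta : int -> W.
Hypothesis beta_path : edge_path gen Ray beta.
Hypothesis beta_quasi : quasi_geodesic gen R Ray beta.

Let b (k : nat) : W := beta k%:Z.

Lemma ray_step k : exists s, b k.+1 = (b k * gen s)%g.
Proof.
have [_ /(_ k%:Z)] := beta_path; rewrite /in_dom /= => /(_ isT) /=.
have -> : (k%:Z + 1 = k.+1%:Z) by lia.
by move=> /(_ isT)/existsP[s /eqP E]; exists s.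
Qed.

Lemma path_edge_ray k : path_edge beta k%:Z = edge (b k) (b k.+1).
Proof. by rewrite /path_edge; have -> : (k%:Z + 1 = k.+1%:Z) by lia. Qed.

(** Quasi-geodesicity enters in this form; the subtraction is truncated, so only [q <= p] has
    content. *)
Lemma ray_proper : exists Phi : nat -> nat, forall c p q,
  (len ((b p)^-1 * b q)%g <= c)%N -> (p - q <= Phi c)%N.
Proof.
have [lam [eps [lam0 eps0 qg]]] := beta_quasi.
exists (fun c => Num.bound (lam * c%:R + eps)) => c p q pq.
case: (leqP q p) => [qp|/ltnW]; last by rewrite -subn_eq0 => /eqP->.
have := qg p%:Z q%:Z isT isT; rewrite distE distrC.
have -> : `|q%:Z - p%:Z| = (p - q)%N%:Z by lia.
move=> h; rewrite ltnW// -(ltr_nat R).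
have c0 : 0 <= lam * c%:R + eps by rewrite addr_ge0// mulr_ge0// ltW.
apply: le_lt_trans (archi_boundP c0); apply: le_trans h _.
by rewrite lerD2r ler_wpM2l ?ler_nat// ltW.
Qed.

Lemma tracked_bounded D alpha' : geodesic gen D alpha' ->
  tracked gen Ray beta D alpha' -> bounded_bracket_number gen Ray beta.
Proof.
move=> geo [K trk].
have [l lP] : {l : nat -> int & forall k, in_dom D (l k) /\
    (len ((b k)^-1 * alpha' (l k))%g <= K)%N}.
  apply: (@boolp.choice _ _ (fun k z => in_dom D z /\
    (len ((b k)^-1 * alpha' z)%g <= K)%N)) => k.
  by have [|z zD zK] := trk k%:Z; [|exists z; rewrite -distE].
have [Phi PhiP] := ray_proper.
have [n nP] := tracked_crossings ray_step PhiP
  (fun p q => etrans (congr1 Posz (esym (distE _ _))) (geo _ _ (lP p).1 (lP q).1))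
  (fun p => (lP p).2).
exists #|{: n.-bseq S * S}| => -[k|//] _; apply: (@shallow_walls_bounded n (b k)).
move=> Q [[r _ ->] [[i|i] [[j|j] [/andP[// i0 _] /andP[// j0 _] ikj]]]].
rewrite !path_edge_ray => ci cj.
have [g [s [rg gi gi']]] := wall_edge ci.
have [g' [s' [rg' gj gj']]] := wall_edge cj.
exists r, g; split=> //; apply: (nP i k j).
- by have [w [t [-> _]]] := rg; exact: root_act (root_alpha t).
- by move: ikj; lia.
- by exists s; left.
exists s'; case: (reflection_of_inj rg rg') => ->; first by left.
by right; rewrite !actN gj gj' opprK.
Qed.

(** Roots of [D] are all positive at [b k], so no two are opposite and their walls are distinct. A
    sign change before [k] and one after it give the bracketing edges. *)
Lemma bracket_bound N k (D : seq V) : (bracketing_walls gen Ray beta k%:Z #<= `I_N)%card ->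
  uniq D -> (forall g, g \in D -> [/\ pos (act (b k)^-1%g g), neg (act (b 0)^-1%g g) &
     exists2 j, (k <= j)%N & neg (act (b j)^-1%g g)]) -> (size D <= N)%N.
Proof.
move=> hN uD hD.
have [rf rfP] : {rf : V -> W & forall v, isroot v -> reflection_of (rf v) v}.
  apply: (@boolp.choice _ _ (fun v r => isroot v -> reflection_of r v)) => v.
  case: (pselect (isroot v)) => [/reflection_of_ex[r rv]|h]; first by exists r.
  by exists 1%g.
have root_at j v : isroot v -> isroot (act (b j)^-1%g v) by exact: root_act.
have edge_at j v : isroot v ->
    (pos (act (b j)^-1%g v) /\ neg (act (b j.+1)^-1%g v)) \/
    (neg (act (b j)^-1%g v) /\ pos (act (b j.+1)^-1%g v)) ->
    wall_of gen (rf v) (path_edge beta j%:Z).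
  move=> rv; rewrite path_edge_ray; have [s ->] := ray_step j.
  exact: crossed_edge (rfP v rv).
pose f (i : 'I_(size D)) := wall_of gen (rf (nth 0 D i)).
have Droot i : (i < size D)%N -> isroot (nth 0 D i).
  by move=> /(mem_nth 0)/hD[[rv _] _ _]; exact: root_of_act rv.
have finj : injective f.
  move=> i i' E; apply/val_inj/eqP; rewrite -(nth_uniq 0 (ltn_ord i) (ltn_ord i') uD).
  have ri := rfP _ (Droot _ (ltn_ord i)); have ri' := rfP _ (Droot _ (ltn_ord i')).
  have rE := wall_of_inj (reflection_of_reflection ri) E.
  rewrite rE in ri; case: (reflection_of_inj ri ri') => [->//|vE].
  have [pi _ _] := hD _ (mem_nth 0 (ltn_ord i)).
  have [pi' _ _] := hD _ (mem_nth 0 (ltn_ord i')).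
  by case: (pos_neg pi); rewrite vE actN; exact: negN.
rewrite -card_le_II; apply: card_le_trans hN.
apply: (@card_le_trans _ _ _ [set: 'I_(size D)]%classic).
  by have /card_eqPle[] := @card_II (size D).
apply: (@card_le_trans _ _ _ (range f)).
  by have /card_eqPle[] := inj_card_eq (in2W finj : {in [set: 'I_(size D)]%classic &, injective f}).
apply: subset_card_le => _ [i _ <-].
have [pk n0 [j kj nj]] := hD _ (mem_nth 0 (ltn_ord i)).
have rv := Droot _ (ltn_ord i); set v := nth 0 D i in pk n0 nj rv *.
split; first by exists (rf v) => //; exact: reflection_of_reflection (rfP v rv).
have [i1 [ik1 p1 p1']] := @sign_change (fun q => neg (act (b q)^-1%g v)) _ _ (leq0n k) n0
  (fun h => pos_neg pk h).
have [j1 [jk1 q1 q1']] := @sign_change (fun q => pos (act (b q)^-1%g v)) _ _ kj pk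
  (fun h => pos_neg h nj).
exists i1%:Z, j1%:Z; split=> //; first lia.
  by apply: edge_at => //; right; split=> //; exact: pos_contra (root_at _ _ rv) p1'.
by apply: edge_at => //; left; split=> //; exact: neg_contra (root_at _ _ rv) q1'.
Qed.

Lemma bounded_tracked : bounded_bracket_number gen Ray beta ->
  exists D alpha', [/\ edge_path gen D alpha', geodesic gen D alpha' &
    tracked gen Ray beta D alpha'].
Proof.
move=> [N NP].
have [C [p [p0 bp pC]]] := @monotone_chain b N
  (fun k D uD hD => @bracket_bound N k D (NP k%:Z isT) uD hD).
have [Phi PhiP] := ray_proper.
have unb n : exists k, (n <= len ((b 0)^-1 * p k)%g)%N.
  (* Were this [p k] within [n] of [b 0], then [b k] would be within [n + C] of it and [k] at most
     [Phi (n + C)]. *)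
  exists (Phi (n + C)%N).+1; rewrite leqNgt; apply/negP => h.
  have := PhiP (n + C)%N (Phi (n + C)%N).+1 0%N.
  rewrite subn0 ltnn => h'; suff : false by []. 
  apply: h'; rewrite len_sym; apply: leq_trans (len_triangle (p (Phi (n + C)%N).+1) _ _) _.
  by rewrite leq_add// ltnW.
have [a [a_step a_geo a_p]] := geodesic_ray p0 bp unb.
exists Ray, (fun z => a `|z|%N); split.
- split=> // -[k|//] _ _; have [s E] := a_step k; apply/existsP; exists s.
  have -> : `|(k%:Z + 1)%R|%N = k.+1 by lia.
  by rewrite E.
- move=> [k|//] [l|//] _ _; rewrite distE /=.
  case: (leqP k l) => [kl|/ltnW lk]; first by rewrite a_geo//; lia.
  by rewrite len_sym a_geo//; lia.
exists C => -[k|//] _; have [i iE] := a_p k; exists i%:Z => //.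
by rewrite distE /= iE len_sym.
Qed.

End Main.

End CoxeterGroup.

Theorem corollary6p2 (R : realType) (W : groupType) (S : finType)
    (m : S -> S -> option nat) (gen : S -> W) (beta : int -> W)
    (HW : coxeter_system m gen)
    (Hbeta : edge_path gen Ray beta)
    (Hquasi : quasi_geodesic gen R Ray beta) :
  (exists (D : path_shape) (alpha : int -> W),
     [/\ edge_path gen D alpha,
         geodesic gen D alpha
       & tracked gen Ray beta D alpha])
  <-> bounded_bracket_number gen Ray beta.
Proof.
split=> [[D [alpha [_ geo trk]]]|bounded].
  exact: (tracked_bounded HW Hbeta Hquasi geo trk).
exact: (bounded_tracked HW Hbeta Hquasi bounded).
Qed.
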